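(* The $2$-Wasserstein space $(\mathcal P_2(\mathbb R^n)\times\mathcal P_2(\mathbb R^n),W_2^2)$ is an NNCC space.
   Context: $\mathcal P_2(\mathbb R^n)$ is the set of Borel probability measures on $\mathbb R^n$ with finite second moment, and $W_2^2(\mu,\nu)=\min_{\pi\in\Pi(\mu,\nu)}\int|x-y|^2\,d\pi(x,y)$, where $\Pi(\mu,\nu)$ is the set of couplings of $\mu$ and $\nu$. For sets $X,Y$ and a (here finite) cost $c\colon X\times Y\to\mathbb R$, a pair $(\mathrm x,\bar y)$ with $\mathrm x\colon[0,1]\to X$ an arbitrary function (no continuity required) and $\bar y\in Y$ is a variational c-segment if for all $s\in(0,1)$ and $y\in Y$, $$c(\mathrm x(s),\bar y)-c(\mathrm x(s),y)\le (1-s)[c(\mathrm x(0),\bar y)-c(\mathrm x(0),y)]+s[c(\mathrm x(1),\bar y)-c(\mathrm x(1),y)].$$ $(X\times Y,c)$ is an NNCC space if for every $(x_0,x_1,\bar y)\in X\times X\times Y$ there exists a variational c-segment $(\mathrm x,\bar y)$ with $\mathrm x(0)=x_0$ and $\mathrm x(1)=x_1$. *)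

(* Defs.v *)
From HB Require Import structures.
From mathcomp Require Import all_boot all_order all_algebra.
From mathcomp Require Import all_classical all_reals all_analysis.

Set Implicit Arguments.
Unset Strict Implicit.
Unset Printing Implicit Defensive.

Import Order.TTheory GRing.Theory Num.Theory.
Import numFieldNormedType.Exports.

Local Open Scope classical_set_scope.
Local Open Scope ring_scope.

(* [{i01 R}] is the unit interval of R, with [s%:num] the underlying real. *)
Definition variational_c_segment (R : realType) (X Y : Type) (c : X -> Y -> R)
    (x : {i01 R} -> X) (ybar : Y) : Prop :=
  forall (s : {i01 R}) (y : Y), 0 < s%:num < 1 ->
    c (x s) ybar - c (x s) y <=
      (1 - s%:num) * (c (x 0%:i01) ybar - c (x 0%:i01) y)
      + s%:num * (c (x 1%:i01) ybar - c (x 1%:i01) y).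

Definition NNCC_space (R : realType) (X Y : Type) (c : X -> Y -> R) : Prop :=
  forall (x0 x1 : X) (ybar : Y), exists x : {i01 R} -> X,
    [/\ variational_c_segment c x ybar, x 0%:i01 = x0 & x 1%:i01 = x1].

(* R^n with its Borel sigma-algebra. *)
Notation Rn R n := (g_sigma_algebraType (@open 'rV[R]_n)).

(* Squared Euclidean norm; the library norm on ['rV[R]_n] is the sup norm,
   which induces the same topology. *)
Definition sqnorm (R : realType) (n : nat) (x : 'rV[R]_n) : R :=
  \sum_(i < n) x ord0 i ^+ 2.

Record P2 (R : realType) (n : nat) := MkP2 {
  P2_prob :> probability (Rn R n) R;
  P2_moment : (\int[P2_prob]_x (sqnorm x)%:E < +oo)%E
}.

(* Marginals are compared on measurable sets only: a measure is a total set
   function that is unconstrained on non-measurable sets. *)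
Definition couplings (R : realType) (n : nat)
    (mu nu : probability (Rn R n) R) :
    set (probability (Rn R n * Rn R n)%type R) :=
  [set pi | (forall A, measurable A -> pi (fst @^-1` A) = mu A) /\
            (forall B, measurable B -> pi (snd @^-1` B) = nu B)].

Definition transport_cost (R : realType) (n : nat)
    (pi : probability (Rn R n * Rn R n)%type R) : \bar R :=
  (\int[pi]_z (sqnorm ((z.1 : 'rV[R]_n) - (z.2 : 'rV[R]_n)))%:E)%E.

(* The infimum is finite (the product coupling has finite cost) and attained,
   so [fine] loses nothing and this is the minimum over couplings. *)
Definition W2sq (R : realType) (n : nat) (mu nu : P2 R n) : R :=
  fine (ereal_inf [set transport_cost pi | pi in couplings mu nu]).

(* Main.v *)
Require Import Defs.
From mathcomp Require Import all_boot all_order all_algebra.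
From mathcomp Require Import all_classical all_reals all_analysis.
From mathcomp Require Import measurable_realfun.
From HB Require Import structures.
From mathcomp Require Import ring lra.
Set Implicit Arguments.
Unset Strict Implicit.
Unset Printing Implicit Defensive.
Import Order.TTheory GRing.Theory Num.Theory.
Import numFieldNormedType.Exports.
Local Open Scope classical_set_scope.
Local Open Scope ring_scope.

(** For points of R^n the function |x - y|^2 - |x - z|^2 is affine in x.  Hence,
    if (x0, x1, y, z) are random vectors and xs := (1 - s) x0 + s x1, then
      E|xs - y|^2 + (1 - s) E|x0 - z|^2 + s E|x1 - z|^2
        = E|xs - z|^2 + (1 - s) E|x0 - y|^2 + s E|x1 - y|^2.        (1)
    Given mu0, mu1 and the base point nubar, couple (x0, x1, y) in such a way
    that both (x0, y) and (x1, y) are optimal couplings with second marginal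
    nubar, and let mus be the law of xs: this is a generalized geodesic with
    base nubar.  For a competitor nu, adjoin z of law nu so that (xs, z) is an
    optimal coupling of mus and nu.  On the right of (1) all three expectations
    are then squared Wasserstein distances; those on the left bound the squared
    distances W(mus, nubar), W(mu0, nu), W(mu1, nu) from above.  Rearranged,
    this is the inequality that defines a variational c-segment.

    Two facts about measures carry the argument: optimal couplings exist
    ([optimal_coupling]), and a new variable can be adjoined to a probability
    space with a prescribed joint law with an old one ([transfer], the gluing
    lemma).  Both follow from one extension theorem, [biadditive_extension]: a
    set function p A B that is finitely additive in A and in B separately, and
    whose marginals are probability measures, the first one Borel on R^n, is
    the restriction to rectangles of a probability measure on the product.
    Countable additivity comes for free because the first marginal is inner
    regular for compact sets ([regular_compact]).

    For gluing, p A D is the integral over D of the conditional probability of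
    A, a Radon-Nikodym derivative taken for each A separately.  For optimal couplings, p A B is the limit of pi_k (A * B) along
    an ultrafilter, for a minimizing sequence of couplings pi_k; finite
    additivity passes to the limit, and the cost is lower semicontinuous
    because it is a pointwise limit of step functions on rectangles that lie
    below it ([lsc_transport_cost]). *)

(** * The Borel sigma-algebra of R^n *)

Section rational_boxes.
Context (R : realType) (n : nat).
Implicit Types U : set 'rV[R]_n.

(** Closed balls of the sup norm with rational centre and radius 1/(k+1): there
    are countably many of them, and membership is a condition on each
    coordinate separately. *)
Definition rat_box (q : 'rV[rat]_n * nat) : set 'rV[R]_n :=
  [set x | forall i, `|x ord0 i - ratr (q.1 ord0 i)| <= q.2.+1%:R^-1].

Lemma closed_rat_box q : closed (rat_box q).
Proof.
rewrite (_ : rat_box q = \bigcap_(i in setT)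
    ((fun x : 'rV[R]_n => x ord0 i) @^-1`
      (closed_ball (ratr (q.1 ord0 i) : R) q.2.+1%:R^-1))).
  apply: closed_bigI => i _.
  apply: preimage_closed; last exact: closed_ball_closed.
  by move=> x _; exact: coord_continuous.
apply/seteqP; split => x /= xq i; first move=> _.
  by rewrite closed_ballE ?invr_gt0//= /closed_ball_/= distrC.
by have := xq i I; rewrite closed_ballE ?invr_gt0//= /closed_ball_/= distrC.
Qed.

Lemma open_rat_box U x : open U -> U x -> exists2 q, rat_box q x & rat_box q `<=` U.
Proof.
move=> oU Ux.
have /nbhs_ballP[e /= e0 xeU] : nbhs x U by exact: open_nbhs_nbhs.
have [k ke] : exists k, k.+1%:R^-1 < e / 2.
  have e20 : 0 < e / 2 by rewrite divr_gt0.
  have [N _ /(_ N (leqnn _)) /=] := near_infty_natSinv_lt (PosNum e20).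
  by move=> H; exists N.
have /choice[r rP] : forall i : 'I_n, exists r : rat, `|x ord0 i - ratr r| <= k.+1%:R^-1.
  move=> i; have k0 : 0 < k.+1%:R^-1 :> R by rewrite invr_gt0.
  have /rat_in_itvoo[r] : x ord0 i - k.+1%:R^-1 < x ord0 i + k.+1%:R^-1.
    by rewrite ltrBlDr -addrA ltrDl addr_gt0.
  rewrite in_itv/= => /andP[r1 r2]; exists r.
  by apply/ltW; rewrite ltr_distlC r1 r2.
exists (\row_i r i, k); first by move=> i; rewrite mxE; exact: rP.
move=> y yq; apply: xeU; split => // i j; rewrite ord1.
have := yq j; have := rP j; rewrite mxE /ball/= /ball_ => xr yr.
have -> : x ord0 j - y ord0 j = (x ord0 j - ratr (r j)) - (y ord0 j - ratr (r j)) by ring.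
apply: (le_lt_trans (ler_normB _ _)).
by apply: (le_lt_trans (lerD xr yr)); rewrite [ltRHS]splitr ltrD.
Qed.

(** Indexing by all of [nat], with empty sets as padding, avoids carrying a
    countable index type around. *)
Lemma open_bigcup_rat_box U : open U -> exists B : nat -> set 'rV[R]_n,
  (forall k, B k = set0 \/ exists q, B k = rat_box q) /\ U = \bigcup_k B k.
Proof.
move=> oU.
exists (fun k => if unpickle k is Some q then
   (if `[< rat_box q `<=` U >] then rat_box q else set0) else set0); split.
  move=> k; case: unpickle => [q|]; last by left.
  by case: ifP => _; [right; exists q|left].
apply/seteqP; split => x.
  move=> Ux; have [q qx qU] := open_rat_box oU Ux.
  by exists (pickle q) => //; rewrite pickleK; case: asboolP.
by move=> [k _]; case: unpickle => // q; case: asboolP => // + qx; exact.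
Qed.

End rational_boxes.

Section borel_measurability.
Context (R : realType) (n : nat).

Lemma open_measurable_Rn (U : set 'rV[R]_n) : open U -> measurable (U : set (Rn R n)).
Proof. exact: sub_sigma_algebra. Qed.

Lemma closed_measurable_Rn (F : set 'rV[R]_n) :
  closed F -> measurable (F : set (Rn R n)).
Proof.
move=> cF; rewrite -[F]setCK; apply: measurableC; apply: open_measurable_Rn.
exact: closed_openC.
Qed.

Lemma measurable_coord (i : 'I_n) :
  measurable_fun setT (fun x : Rn R n => (x : 'rV[R]_n) ord0 i).
Proof.
apply: (measurability _ (RGenOpens.measurableE R)) => _ [_ [a [b ->]] <-].
rewrite setTI; apply: open_measurable_Rn.
apply: open_comp; last exact: interval_open.
by move=> x _; exact: coord_continuous.
Qed.

(** Every open set is a countable union of boxes, so the Borel sigma-algebra of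
    R^n is generated by the coordinates. *)
Lemma measurable_coordP d (T : measurableType d) (f : T -> 'rV[R]_n) :
  (forall i, measurable_fun setT (fun t => f t ord0 i)) ->
  measurable_fun setT (f : T -> Rn R n).
Proof.
move=> mf; apply: (measurability _ (erefl : @measurable _ (Rn R n) = _)).
move=> _ [U oU <-]; rewrite setTI.
have [B [BP ->]] := open_bigcup_rat_box oU.
rewrite preimage_bigcup; apply: bigcup_measurable => k _.
have [->|[q ->]] := BP k; first by rewrite preimage_set0.
rewrite (_ : _ @^-1` _ = \bigcap_(i in setT) ((fun t => f t ord0 i) @^-1`
      (closed_ball (ratr (q.1 ord0 i) : R) q.2.+1%:R^-1))).
  apply: fin_bigcap_measurable => // i _.
  rewrite -[_ @^-1` _]setTI; apply: mf => //; rewrite -[X in measurable X]setCK.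
  apply: measurableC; apply: open_measurable; apply: closed_openC.
  exact: closed_ball_closed.
apply/seteqP; split => x /= xq i; first move=> _.
  by rewrite closed_ballE ?invr_gt0//= /closed_ball_/= distrC.
by have := xq i I; rewrite closed_ballE ?invr_gt0//= /closed_ball_/= distrC.
Qed.

End borel_measurability.

(** * Inner and outer regularity of finite Borel measures on R^n *)

Section measure_continuity_lt.
Context (R : realType).
Local Open Scope ereal_scope.

Lemma nonincreasing_measure_lt d (T : measurableType d)
    (m : {finite_measure set T -> \bar R}) (E : nat -> set T) (a : \bar R) :
  (forall k, measurable (E k)) -> nonincreasing_seq E ->
  m (\bigcap_k E k) < a -> exists k, m (E k) < a.
Proof.
move=> mE dE ma.
have mcap : measurable (\bigcap_k E k) by exact: bigcapT_measurable.
have E0 : m (E 0%N) < +oo by rewrite ltey_eq fin_num_measure.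
have /(_ _ (open_ereal_lt' ma)) := nonincreasing_cvg_mu E0 mE mcap dE.
by move=> [N _ /(_ N (leqnn _)) /=]; exists N.
Qed.

Lemma nondecreasing_measure_diff_lt d (T : measurableType d)
    (m : {finite_measure set T -> \bar R}) (E : nat -> set T) (A : set T)
    (a : \bar R) :
  (forall k, measurable (E k)) -> nondecreasing_seq E -> measurable A ->
  m (A `\` \bigcup_k E k) < a -> exists k, m (A `\` E k) < a.
Proof.
move=> mE iE mA; rewrite setDE setC_bigcup.
rewrite (_ : A `&` _ = \bigcap_k (A `\` E k)); last first.
  apply/seteqP; split => [x [Ax nE] k _|x nE]; first by split => //; exact: nE.
  by split; [have [] := nE 0%N I|move=> k _; have [] := nE k I].
apply: nonincreasing_measure_lt => [k|i j ij]; first exact: measurableD.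
by apply/subsetPset; apply: setDS; apply/subsetPset; exact: iE.
Qed.

End measure_continuity_lt.

Section regularity.
Context (R : realType) (n : nat) (mu : {finite_measure set (Rn R n) -> \bar R}).
Local Open Scope ereal_scope.

(** Approximation from inside by closed sets, not compact ones: only this
    version is stable under complement. *)
Definition regular_set (A : set 'rV[R]_n) := forall e : R, (0 < e)%R ->
  exists F U : set 'rV[R]_n, [/\ closed F, open U, F `<=` A, A `<=` U &
    mu (U `\` F) < e%:E].

(** An open set is an increasing union of finite unions of closed boxes. *)
Lemma regular_open U : open U -> regular_set U.
Proof.
move=> oU e e0; have [B [BP UE]] := open_bigcup_rat_box oU.
have cB k : closed (B k).
  by have [->|[q ->]] := BP k; [exact: closed0|exact: closed_rat_box].
pose E k := \bigcup_(i < k) B i.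
have cE k : closed (E k).
  by rewrite /E bigcup_mkord; apply: closed_bigsetU => i _.
have UEE : U = \bigcup_k E k.
  rewrite UE; apply/seteqP; split => x [k] => [_ Bx|_ [i _ Bx]]; last by exists i.
  by exists k.+1 => //; exists k => /=.
have [//|//|||k Hk] := @nondecreasing_measure_diff_lt _ _ _ mu E U e%:E.
- by move=> k; exact: closed_measurable_Rn.
- by move=> i j ij; apply/subsetPset => x [k /= ki Bx]; exists k => //=;
  exact: leq_trans ij.
- exact: open_measurable_Rn.
- by rewrite -UEE setDv measure0 lte_fin.
exists (E k), U; split => //.
by rewrite UEE => x Ex; exists k.
Qed.

Lemma regular_setC A : regular_set A -> regular_set (~` A).
Proof.
move=> rA e e0; have [F [U [cF oU FA AU m]]] := rA e e0.
exists (~` U), (~` F); split.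
- exact: open_closedC.
- exact: closed_openC.
- exact: subsetC.
- exact: subsetC.
- by rewrite setDE setCK setIC -setDE.
Qed.

(** The union of the inner closed sets need not be closed, hence the passage to
    a finite union by continuity of the measure. *)
Lemma regular_bigcup (A : nat -> set 'rV[R]_n) :
  (forall k, regular_set (A k)) -> regular_set (\bigcup_k A k).
Proof.
move=> rA e e0; have e20 : (0 < e / 2)%R by rewrite divr_gt0.
have /choice[F /choice[U FU]] : forall k, exists F, exists U : set 'rV[R]_n,
    [/\ closed F, open U, F `<=` A k, A k `<=` U &
    mu (U `\` F) < (e / 2 / (2 ^ k.+1)%:R)%:E].
  by move=> k; apply: rA; rewrite divr_gt0.
have cF k : closed (F k) by have [] := FU k.
have oU k : open (U k) by have [] := FU k.
have mF k : measurable (F k : set (Rn R n)) by exact: closed_measurable_Rn.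
have mU k : measurable (U k : set (Rn R n)) by exact: open_measurable_Rn.
pose E k := \bigcup_(i < k) F i.
have cE k : closed (E k).
  by rewrite /E bigcup_mkord; apply: closed_bigsetU => i _.
have UEE : \bigcup_k F k = \bigcup_k E k.
  apply/seteqP; split => x [k] => [_ Bx|_ [i _ Bx]]; last by exists i.
  by exists k.+1 => //; exists k => /=.
have mUU : measurable (\bigcup_k U k : set (Rn R n)) by exact: bigcupT_measurable.
have [//|//|||k Hk] := @nondecreasing_measure_diff_lt _ _ _ mu E (\bigcup_k U k) e%:E.
- by move=> k; exact: closed_measurable_Rn.
- by move=> i j ij; apply/subsetPset => x [k /= ki Bx]; exists k => //=;
  exact: leq_trans ij.
- exact: mUU.
- rewrite -UEE; apply: (@le_lt_trans _ _ (e / 2)%:E); last first.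
    by rewrite lte_fin ltr_pdivrMr// ltr_pMr// ltr1n.
  have mD k : measurable (U k `\` F k : set (Rn R n)) by exact: measurableD.
  apply: (@le_trans _ _ (\sum_(k <oo) mu (U k `\` F k))).
    apply: (measure_sigma_subadditive _ mD).
      by apply: measurableD => //; exact: bigcupT_measurable.
    by move=> x [[k _ Ux] nF]; exists k => //; split => // Fx; apply: nF; exists k.
  apply: (@le_trans _ _ (\sum_(k <oo) (e / 2 / (2 ^ k.+1)%:R)%:E)).
    by apply: lee_nneseries => // k _; apply/ltW; have [] := FU k.
  by apply: (epsilon_trick0 xpredT); exact: ltW.
exists (E k), (\bigcup_k U k); split => //.
- by apply: bigcup_open => i _.
- by move=> x [i _ Fx]; exists i => //; have [_ _ + _ _] := FU i; exact.
- by apply: subset_bigcup => i _; have [] := FU i.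
Qed.

Lemma regular_borel (A : set (Rn R n)) : measurable A -> regular_set A.
Proof.
apply: smallest_sub => //; last by move=> U; exact: regular_open.
split => [|B rB|B rB].
- exact/regular_open/open0.
- by rewrite setTD; exact: regular_setC.
- exact: regular_bigcup.
Qed.

(** A closed set is the increasing union of its intersections with the balls of
    radius k, which are compact. *)
Lemma regular_compact (A : set (Rn R n)) (e : R) : measurable A -> (0 < e)%R ->
  exists K : set 'rV[R]_n, [/\ compact K, K `<=` A & mu (A `\` K) < e%:E].
Proof.
move=> mA e0; have [F [U [cF oU FA AU muUF]]] := regular_borel mA e0.
pose E (k : nat) := F `&` [set x : 'rV[R]_n | (`|x| <= k%:R)%R].
have cE k : closed (E k).
  apply: closedI => //.
  rewrite (_ : [set x | _] =
      (fun x : 'rV[R]_n => `|x|%R) @^-1` [set y : R | (y <= k%:R)%R])//.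
  apply: preimage_closed; last exact: closed_le.
  by move=> x _; exact: norm_continuous.
have FE : F = \bigcup_k E k.
  apply/seteqP; split => x; last by move=> [k _ []].
  move=> Fx; exists (Num.bound `|x|%R) => //; split => //=.
  by apply/ltW/archi_boundP.
have mF := closed_measurable_Rn cF.
have [//|//|||k Hk] := @nondecreasing_measure_diff_lt _ _ _ mu E A e%:E.
- by move=> k; exact: closed_measurable_Rn.
- move=> i j ij; apply/subsetPset => x [Fx xi]; split => //=.
  by rewrite (le_trans xi)// ler_nat.
- exact: mA.
- rewrite -FE; apply: le_lt_trans muUF; apply: le_measure; rewrite ?inE.
  + exact: measurableD.
  + by apply: measurableD => //; exact: open_measurable_Rn.
  + exact: setSD.
exists (E k); split => //; last by move=> x [Fx _]; exact: FA.
apply: bounded_closed_compact => //.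
exists k%:R; split => [|y ky x [_ /= xk]]; first exact: num_real.
by rewrite (le_trans xk)// ltW.
Qed.

Lemma regular_outer (A : set (Rn R n)) (e : R) : measurable A -> (0 < e)%R ->
  exists U : set 'rV[R]_n, [/\ open U, A `<=` U & mu (U `\` A) < e%:E].
Proof.
move=> mA e0; have [F [U [cF oU FA AU muUF]]] := regular_borel mA e0.
exists U; split => //; apply: le_lt_trans muUF; apply: le_measure; rewrite ?inE.
- by apply: measurableD => //; exact: open_measurable_Rn.
- apply: measurableD; first exact: open_measurable_Rn.
  exact: closed_measurable_Rn.
- exact: setDS.
Qed.

End regularity.

(** * Extending a biadditive set function to a measure on a product *)
Record biadditive (R : realType) d1 d2 (X : measurableType d1)
    (Y : measurableType d2) (p : set X -> set Y -> R) : Prop := Biadditive {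
  biadd_ge0 : forall A B, measurable A -> measurable B -> 0 <= p A B ;
  biaddDl : forall A A' B, measurable A -> measurable A' -> measurable B ->
    [disjoint A & A'] -> p (A `|` A') B = p A B + p A' B ;
  biaddDr : forall A B B', measurable A -> measurable B -> measurable B' ->
    [disjoint B & B'] -> p A (B `|` B') = p A B + p A B' }.

Section biadditive_theory.
Context (R : realType) d1 d2 (X : measurableType d1) (Y : measurableType d2).
Variable p : set X -> set Y -> R.
Hypothesis pB : biadditive p.

Lemma biadd0l B : measurable B -> p set0 B = 0.
Proof.
move=> mB; have := @biaddDl _ _ _ _ _ _ pB set0 set0 B.
rewrite setU0 => /(_ measurable0 measurable0 mB).
rewrite disj_set2E setI0 eqxx => /(_ isT); lra.
Qed.

Lemma biadd0r A : measurable A -> p A set0 = 0.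
Proof.
move=> mA; have := @biaddDr _ _ _ _ _ _ pB A set0 set0.
rewrite setU0 => /(_ mA measurable0 measurable0).
rewrite disj_set2E setI0 eqxx => /(_ isT); lra.
Qed.

Lemma biadd_splitl A A' B : measurable A -> measurable A' -> measurable B ->
  p A B = p (A `&` A') B + p (A `\` A') B.
Proof.
move=> mA mA' mB; rewrite -(biaddDl pB) ?setUIDK//.
- exact: measurableI.
- exact: measurableD.
- by rewrite disj_set2E; apply/eqP; rewrite setDE setIACA setICr setI0.
Qed.

Lemma biadd_splitr A B B' : measurable A -> measurable B -> measurable B' ->
  p A B = p A (B `&` B') + p A (B `\` B').
Proof.
move=> mA mB mB'; rewrite -(biaddDr pB) ?setUIDK//.
- exact: measurableI.
- exact: measurableD.
- by rewrite disj_set2E; apply/eqP; rewrite setDE setIACA setICr setI0.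
Qed.

Lemma biadd_lel A A' B : measurable A -> measurable A' -> measurable B ->
  A `<=` A' -> p A B <= p A' B.
Proof.
move=> mA mA' mB AA'; rewrite (@biadd_splitl A' A)// setIidr// lerDl.
by apply: (biadd_ge0 pB) => //; exact: measurableD.
Qed.

Lemma biadd_ler A B B' : measurable A -> measurable B -> measurable B' ->
  B `<=` B' -> p A B <= p A B'.
Proof.
move=> mA mB mB' BB'; rewrite (@biadd_splitr A B' B)// setIidr// lerDl.
by apply: (biadd_ge0 pB) => //; exact: measurableD.
Qed.

Lemma biadd_eq0 A B : measurable A -> measurable B -> A `*` B = set0 ->
  p A B = 0.
Proof.
move=> mA mB AB0; have [->|/set0P[x Ax]] := eqVneq A set0; first exact: biadd0l.
have [->|/set0P[y By]] := eqVneq B set0; first exact: biadd0r.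
by have : (A `*` B) (x, y) by []; rewrite AB0.
Qed.

(** Induction on the number of covering rectangles: cutting along the last one,
    F N * G N, leaves A * (B minus G N) and (A minus F N) * (B meet G N), both
    covered by the first N rectangles, once with every G i restricted to the
    complement of G N and once with every G i restricted to G N. *)
Lemma biadd_subadditive N (F : nat -> set X) (G : nat -> set Y) A B :
  (forall i, measurable (F i)) -> (forall i, measurable (G i)) ->
  measurable A -> measurable B ->
  A `*` B `<=` \bigcup_(i in `I_N) (F i `*` G i) ->
  p A B <= \sum_(i < N) p (F i) (G i).
Proof.
move=> mF; elim: N G A B => [|N IH] G A B mG mA mB.
  by rewrite big_ord0 II0 bigcup_set0 subset0 => /(biadd_eq0 mA mB) ->.
rewrite big_ord_recr /= => AB.
have mGI i C : measurable C -> measurable (G i `&` C) by exact: measurableI.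
have mGD i C : measurable C -> measurable (G i `\` C) by exact: measurableD.
rewrite (biadd_splitr mA mB (mG N)).
rewrite (biadd_splitl mA (mF N) (measurableI _ _ mB (mG N))).
have le1 : p (A `\` F N) (B `&` G N) <= \sum_(i < N) p (F i) (G i `&` G N).
  apply: (IH (fun i => G i `&` G N)) => //; try by move=> i; apply: measurableI.
  - exact: measurableD.
  - exact: measurableI.
  move=> [x y] /= [[Ax nFx] [By Gy]].
  have [i /=] := AB (x, y) (conj Ax By).
  by rewrite ltnS leq_eqVlt => /predU1P[->|iN] [] //=; exists i.
have le2 : p A (B `\` G N) <= \sum_(i < N) p (F i) (G i `\` G N).
  apply: (IH (fun i => G i `\` G N)) => //; try by move=> i; apply: measurableD.
  - exact: measurableD.
  move=> [x y] /= [Ax [By nGy]].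
  have [i /=] := AB (x, y) (conj Ax By).
  by rewrite ltnS leq_eqVlt => /predU1P[->|iN] [] //=; exists i.
have le3 : p (A `&` F N) (B `&` G N) <= p (F N) (G N).
  apply: (le_trans (@biadd_lel _ (F N) _ _ _ _ _)) => //;
    [exact: measurableI|exact: measurableI|].
  by apply: biadd_ler => //; exact: measurableI.
have -> : \sum_(i < N) p (F i) (G i) =
   \sum_(i < N) p (F i) (G i `&` G N) + \sum_(i < N) p (F i) (G i `\` G N).
  by rewrite -big_split /=; apply: eq_bigr => i _; exact: biadd_splitr.
lra.
Qed.

(** Induction by the same cut.  Above G N the rectangles F i * G i are
    disjoint from F N * G N, so that F N may be removed from each F i. *)
Lemma biadd_superadditive N (F : nat -> set X) (G : nat -> set Y) A B :
  (forall i, measurable (F i)) -> (forall i, measurable (G i)) ->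
  measurable A -> measurable B ->
  (forall i, (i < N)%N -> F i `*` G i `<=` A `*` B) ->
  (forall i j, (i < N)%N -> (j < N)%N -> i <> j ->
     (F i `*` G i) `&` (F j `*` G j) = set0) ->
  \sum_(i < N) p (F i) (G i) <= p A B.
Proof.
elim: N F G A B => [|N IH] F G A B mF mG mA mB FGAB tFG.
  by rewrite big_ord0; exact: (biadd_ge0 pB).
have mGI i C : measurable C -> measurable (G i `&` C) by exact: measurableI.
have mGD i C : measurable C -> measurable (G i `\` C) by exact: measurableD.
have mBG : measurable (B `&` G N) by exact: measurableI.
rewrite big_ord_recr /= (biadd_splitr mA mB (mG N)).
rewrite (biadd_splitl mA (mF N) mBG).
have le1 : \sum_(i < N) p (F i `\` F N) (G i `&` G N) <=
           p (A `\` F N) (B `&` G N).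
  apply: (IH (fun i => F i `\` F N) (fun i => G i `&` G N)) => //;
    try by move=> i; apply: measurableD.
  - by move=> i; exact: measurableI.
  - exact: measurableD.
  - move=> i iN [x y] /= [[Fx nFx] [Gy GNy]].
    by have [] := FGAB i (ltnW iN) (x, y) (conj Fx Gy).
  - move=> i j iN jN ij; rewrite -subset0.
    move=> -[x y] /= [[[Fx _] [Gy _]] [[Fx' _] [Gy' _]]].
    by have /seteqP[/(_ (x, y)) + _] := tFG i j (ltnW iN) (ltnW jN) ij; apply.
have le2 : \sum_(i < N) p (F i) (G i `\` G N) <= p A (B `\` G N).
  apply: (IH F (fun i => G i `\` G N)) => //; try by move=> i; apply: measurableD.
  - exact: measurableD.
  - move=> i iN [x y] /= [Fx [Gy GNy]].
    by have [] := FGAB i (ltnW iN) (x, y) (conj Fx Gy).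
  - move=> i j iN jN ij; rewrite -subset0 => -[x y] /= [[Fx [Gy _]] [Fx' [Gy' _]]].
    by have /seteqP[/(_ (x, y)) + _] := tFG i j (ltnW iN) (ltnW jN) ij; apply.
have eqD i : (i < N)%N -> p (F i) (G i `&` G N) = p (F i `\` F N) (G i `&` G N).
  move=> iN; have mGiN : measurable (G i `&` G N) by exact: measurableI.
  rewrite (biadd_splitl (mF i) (mF N) mGiN).
  rewrite [X in X + _]biadd_eq0 ?add0r//; first exact: measurableI.
  rewrite -subset0 => -[x y] /= [[Fx FNx] [Gy GNy]].
  have /seteqP[/(_ (x, y)) + _] : (F i `*` G i) `&` (F N `*` G N) = set0.
    by apply: tFG => //; [exact: ltnW|move=> iNE; rewrite iNE ltnn in iN].
  by apply.
have le3 : p (F N) (G N) <= p (A `&` F N) (B `&` G N).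
  have [FG0|/set0P[[x0 y0] [/= Fx0 Gy0]]] := eqVneq (F N `*` G N) set0.
    by rewrite biadd_eq0//; apply: (biadd_ge0 pB) => //; exact: measurableI.
  have FA : A `&` F N = F N.
    by apply/setIidr => x Fx; have [] := FGAB N (ltnSn N) (x, y0) (conj Fx Gy0).
  have GB : B `&` G N = G N.
    by apply/setIidr => y Gy; have [] := FGAB N (ltnSn N) (x0, y) (conj Fx0 Gy).
  by rewrite FA GB.
have -> : \sum_(i < N) p (F i) (G i) = \sum_(i < N) p (F i `\` F N) (G i `&` G N)
    + \sum_(i < N) p (F i) (G i `\` G N).
  rewrite -big_split /=; apply: eq_bigr => i _.
  by rewrite (biadd_splitr (mF i) (mG i) (mG N)) eqD.
lra.
Qed.

End biadditive_theory.

Definition rect_display : measure_display -> measure_display -> measure_display.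
Proof. exact. Qed.

Section rect_semiring.
Context d1 d2 (X : measurableType d1) (Y : measurableType d2).

(** A copy of the product type, on which the rectangles form the semiring of
    sets needed by the Caratheodory extension. *)
Definition rect_type : Type := (X * Y)%type.

Definition rect : set (set rect_type) :=
  [set A `*` B | A in measurable & B in measurable].

Lemma rect0 : rect set0.
Proof. by exists set0 => //; exists set0 => //; rewrite setX0. Qed.

Lemma rectI : setI_closed rect.
Proof.
move=> _ _ [A mA [B mB <-]] [A' mA' [B' mB' <-]].
exists (A `&` A'); first exact: measurableI.
exists (B `&` B'); first exact: measurableI.
by rewrite setXI.
Qed.

Lemma rectD : semi_setD_closed rect.
Proof.
move=> _ _ [A mA [B mB <-]] [A' mA' [B' mB' <-]].
exists [set (A `\` A') `*` B; (A `&` A') `*` (B `\` B')]; split.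
- exact: finite_set2.
- move=> _ [|] ->.
    by exists (A `\` A'); [exact: measurableD|exists B].
  exists (A `&` A'); first exact: measurableI.
  by exists (B `\` B') => //; exact: measurableD.
- rewrite bigcup_setU1 bigcup_set1; apply/seteqP; split => -[x y] /=.
    move=> [[Ax By] nAB]; have [A'x|nA'x] := pselect (A' x); last by left.
    by right; do !split => //; move=> B'y; exact: nAB.
  by move=> [[[Ax nA'x] By]|[[Ax A'x] [By nB'y]]]; split => // -[].
- move=> _ _ [|] -> [|] -> // [[x y] /=].
    by move=> [[[_ nA'x] _] [[_ A'x] _]].
  by move=> [[[_ A'x] _] [[_ nA'x] _]].
Qed.

HB.instance Definition _ := Pointed.on rect_type.
HB.instance Definition _ :=
  @isSemiRingOfSets.Build (rect_display d1 d2) rect_type rect rect0 rectI rectD.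

End rect_semiring.

Lemma measure_to_probability d (T : measurableType d) (R : realType)
    (m : {measure set T -> \bar R}) : m setT = 1%E ->
  exists P : probability T R, forall A, P A = m A.
Proof.
move=> mT; exists (mnormalize m (dirac point)) => A.
change (mnormalize m (\d_point) A = m A).
by rewrite /mnormalize mT onee_eq0/= invr1 mule1.
Qed.

Section bimeasure_extension.
Context (R : realType) (n : nat) d (Y : measurableType d).
Variables (mu : probability (Rn R n) R) (nu : probability Y R).
Variable p : set (Rn R n) -> set Y -> R.
Hypothesis pB : biadditive p.
Hypothesis pl : forall A, measurable A -> (p A setT)%:E = mu A.
Hypothesis pr : forall B, measurable B -> (p setT B)%:E = nu B.
Local Open Scope ereal_scope.

Let p_lel A B : measurable A -> measurable B -> (p A B)%:E <= mu A.
Proof. by move=> mA mB; rewrite -pl// lee_fin; exact: (biadd_ler pB). Qed.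

Let p_ler A B : measurable A -> measurable B -> (p A B)%:E <= nu B.
Proof. by move=> mA mB; rewrite -pr// lee_fin; exact: (biadd_lel pB). Qed.

Let p_lt A B e : measurable A -> measurable B -> mu A < e%:E -> (p A B < e)%R.
Proof. by move=> mA mB muA; rewrite -lte_fin (le_lt_trans (p_lel mA mB)). Qed.

(** Replace A by a compact K inside it and each F i by an open U i around it, at
    a total cost of order e.  For y in B finitely many of the U i with y in G i
    already cover K; the set E N of the y for which the first N suffice
    increases to B, so that the finite case applies to K * E N for some N. *)
Lemma biadditive_sigma_subadditive (F : nat -> set (Rn R n)) (G : nat -> set Y) A B :
  (forall i, measurable (F i)) -> (forall i, measurable (G i)) ->
  measurable A -> measurable B ->
  A `*` B `<=` \bigcup_i (F i `*` G i) ->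
  (p A B)%:E <= \sum_(i <oo) (p (F i) (G i))%:E.
Proof.
move=> mF mG mA mB AB; apply/lee_addgt0Pr => e e0.
have e30 : (0 < e / 3)%R by rewrite divr_gt0.
have [K [cK KA muK]] := regular_compact mu mA e30.
have mK : measurable (K : set (Rn R n)).
  by apply: closed_measurable_Rn; apply: compact_closed => //; exact: norm_hausdorff.
have /choice[U UP] : forall i, exists U : set 'rV[R]_n,
    [/\ open U, F i `<=` U & mu (U `\` F i) < (e / 3 / (2 ^ i.+1)%:R)%:E].
  by move=> i; apply: regular_outer => //; rewrite divr_gt0// ltr0n expn_gt0.
have mU i : measurable (U i : set (Rn R n)).
  by apply: open_measurable_Rn; have [] := UP i.
pose E N := [set y | B y /\ K `<=` \bigcup_(i in [set i | (i < N)%N /\ G i y]) U i].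
(* membership in E N depends only on which of the G i, i < N, contain y *)
have mE N : measurable (E N).
  rewrite (_ : E N = B `&` \bigcup_(I in [set I : {set 'I_N} |
      K `<=` \bigcup_(i in [set` I]) U i]) \bigcap_(i in [set` I]) G i).
    apply: measurableI => //; apply: fin_bigcup_measurable => // I _.
    by apply: fin_bigcap_measurable => // i _.
  apply/seteqP; split => y [By].
    move=> KU; split => //; exists [set i : 'I_N | `[< G i y >]]%SET => /=.
      move=> x /KU[i [iN Giy] Ux]; exists (Ordinal iN) => //=.
      by rewrite inE; exact/asboolP.
    by move=> i /=; rewrite inE => /asboolP.
  move=> [I /= KI GI]; split => // x /KI[i /= iI Ux]; exists (i : nat) => //.
  by split => //; exact: GI.
have iE : nondecreasing_seq E.
  move=> i j ij; apply/subsetPset => y [By KU]; split => // x /KU[k [ki Gk] Ux].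
  by exists k => //; split => //; exact: leq_trans ij.
have EB : \bigcup_N E N = B.
  apply/seteqP; split => y; first by move=> [N _ []].
  move=> By.
  have : cover_compact K by rewrite -compact_cover.
  move=> /(_ nat [set i | G i y] U)[|x Kx|D DG KD].
  - by move=> i _; have [] := UP i.
  - have [i _ [/= Fx Gy]] := AB (x, y) (conj (KA x Kx) By).
    by exists i => //; have [_ + _] := UP i; apply.
  - exists (\max_(i <- finmap.enum_fset D) i.+1)%N => //; split => // x /KD[i /= iD Ux].
    exists i => //; split; last by have /set_mem := DG i iD.
    by rewrite (@leq_bigmax_seq _ _ _ (fun i => i.+1))//.
have [|N nuN] := @nondecreasing_measure_diff_lt _ _ _ nu E B (e / 3)%:E mE iE mB.
  by rewrite EB setDv measure0 lte_fin.
have le1 : (p A B <= p K B + e / 3)%R.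
  rewrite (biadd_splitl pB mA mK mB) setIidr// lerD2l ltW//.
  by apply: p_lt => //; exact: measurableD.
have le2 : (p K B <= p K (E N) + e / 3)%R.
  rewrite (biadd_splitr pB mK mB (mE N)) setIidr ?lerD2l; last by move=> y [].
  rewrite -lee_fin; apply: le_trans (ltW nuN).
  by apply: p_ler => //; exact: measurableD.
have le3 : (p K (E N) <= \sum_(i < N) p (U i) (G i))%R.
  apply: (biadd_subadditive pB) => // -[x y] /= [Kx [By /(_ x Kx)[i [iN Gy] Ux]]].
  by exists i.
have le4 i : (p (U i) (G i) <= p (F i) (G i) + e / 3 / (2 ^ i.+1)%:R)%R.
  have [_ FU muU] := UP i.
  rewrite (biadd_splitl pB (mU i) (mF i) (mG i)) setIidr// lerD2l ltW//.
  by apply: p_lt => //; exact: measurableD.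
have le5 : (p A B <= \sum_(i < N) p (F i) (G i) +
    \sum_(i < N) e / 3 / (2 ^ i.+1)%:R + 2 * (e / 3))%R.
  have : (\sum_(i < N) p (U i) (G i) <= \sum_(i < N) p (F i) (G i) +
    \sum_(i < N) e / 3 / (2 ^ i.+1)%:R)%R.
    by rewrite -big_split /=; apply: ler_sum => i _.
  lra.
apply: (@le_trans _ _ ((\sum_(i < N) p (F i) (G i))%:E +
    (\sum_(i < N) e / 3 / (2 ^ i.+1)%:R)%:E + (2 * (e / 3))%:E)).
  by rewrite -!EFinD lee_fin.
rewrite -addeA; apply: leeD.
  rewrite -sumEFin -(big_mkord xpredT (fun i => (p (F i) (G i))%:E)).
  apply: nneseries_lim_ge => i _ _.
  by rewrite lee_fin; apply: (biadd_ge0 pB).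
rewrite [leRHS](_ : e%:E = (e / 3)%:E + (2 * (e / 3))%:E); last first.
  by rewrite -EFinD; congr EFin; field.
rewrite leeD2r//; apply: le_trans (epsilon_trick0 xpredT (ltW e30)).
rewrite -sumEFin -(big_mkord xpredT (fun i => (e / 3 / (2 ^ i.+1)%:R)%:E)).
by apply: nneseries_lim_ge => i _ _; rewrite lee_fin divr_ge0// ltW.
Qed.

Local Notation X := (Rn R n).

(** Projecting S recovers the two factors of a nonempty rectangle.  The absolute
    value makes the content nonnegative on sets that are not rectangles too. *)
Definition rect_content (S : set (rect_type X Y)) : \bar R :=
  `|p (fst @` S) (snd @` S)|%:E.

Lemma rect_contentE A B : measurable A -> measurable B ->
  rect_content (A `*` B) = (p A B)%:E.
Proof.
move=> mA mB; rewrite /rect_content; congr EFin.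
have [->|/set0P[x Ax]] := eqVneq A set0.
  by rewrite set0X !image_set0 !(biadd0l pB)// normr0.
have [->|/set0P[y By]] := eqVneq B set0.
  by rewrite setX0 !image_set0 (biadd0l pB)// (biadd0r pB)// normr0.
rewrite -[RHS]ger0_norm; last exact: (biadd_ge0 pB).
congr (`|p _ _|)%R; apply/seteqP; split => z.
- by move=> [[a b] [/= Aa Bb] <-].
- by move=> Az; exists (z, y).
- by move=> [[a b] [/= Aa Bb] <-].
- by move=> Bz; exists (x, z).
Qed.

Let rect_content_ge0 S : 0 <= rect_content S.
Proof. by rewrite lee_fin normr_ge0. Qed.

Let rect_content_semi_additive : measure_function.semi_additive rect_content.
Proof.
move=> F N mF tF; set S := \big[_/_]_(_ < _) _ => -[A mA [B mB SE]].
have /choice[a /choice[b ab]] : forall k, exists a, exists b,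
    [/\ measurable a, measurable b & a `*` b = F k].
  by move=> k; have [a ma [b mb <-]] := mF k; exists a, b.
have ma k : measurable (a k) by have [] := ab k.
have mb k : measurable (b k) by have [] := ab k.
have Fab k : F k = a k `*` b k by have [_ _ ->] := ab k.
have SF : A `*` B = \bigcup_(k in `I_N) (a k `*` b k).
  rewrite SE /S -(bigcup_mkord N F); apply: eq_bigcupr => k _; exact: Fab.
rewrite -SE rect_contentE// (eq_bigr (fun k : 'I_N => (p (a k) (b k))%:E)); last first.
  by move=> k _; rewrite Fab rect_contentE.
rewrite sumEFin; congr EFin; apply/eqP; rewrite eq_le; apply/andP; split.
  by apply: (biadd_subadditive pB) => //; rewrite SF.
apply: (biadd_superadditive pB) => //.
  by move=> i iN; rewrite SF; exact: (bigcup_sup (i := i)).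
move=> i j _ _ ij; rewrite -!Fab.
move/trivIsetP : tF => /(_ i j I I); apply; exact/eqP.
Qed.

Let rect_content_sigma_subadditive :
  measurable_subset_sigma_subadditive rect_content.
Proof.
move=> S F mF [A mA [B mB <-]] SF.
have /choice[a /choice[b ab]] : forall k, exists a, exists b,
    [/\ measurable a, measurable b & a `*` b = F k].
  by move=> k; have [a ma [b mb <-]] := mF k; exists a, b.
have ma k : measurable (a k) by have [] := ab k.
have mb k : measurable (b k) by have [] := ab k.
have Fab k : F k = a k `*` b k by have [_ _ ->] := ab k.
rewrite rect_contentE// (eq_eseriesr (g := fun k => (p (a k) (b k))%:E)); last first.
  by move=> k _; rewrite Fab rect_contentE.
apply: biadditive_sigma_subadditive => //.
by apply: subset_trans SF _; apply: subset_bigcup => k _; rewrite Fab.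
Qed.

HB.instance Definition _ := isContent.Build _ _ _ rect_content
  rect_content_ge0 rect_content_semi_additive.
HB.instance Definition _ := Content_SigmaSubAdditive_isMeasure.Build _ _ _
  rect_content rect_content_sigma_subadditive.

(** A coupling of mu and nu is thus the same thing as a biadditive function with
    these marginals: countable additivity is automatic. *)
Theorem biadditive_extension : exists pi : probability (X * Y)%type R,
  forall A B, measurable A -> measurable B -> pi (A `*` B) = (p A B)%:E.
Proof.
pose m : set (X * Y) -> \bar R := measure_extension rect_content.
have mE A B : measurable A -> measurable B -> m (A `*` B) = (p A B)%:E.
  move=> mA mB; have rAB : @rect _ _ X Y (A `*` B) by exists A => //; exists B.
  rewrite /m /measure_extension measurable_mu_extE; first exact: rect_contentE.
  exact: rAB.
have rectE : @measurable _ (g_sigma_algebraType (@rect _ _ X Y)) =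
    @measurable _ (X * Y)%type.
  by rewrite [RHS]measurable_prod_measurableType.
have m0 : m set0 = 0 by rewrite /m measure0.
have m_ge0 S : 0 <= m S by rewrite /m measure_ge0.
have m_sigma : semi_sigma_additive m.
  move=> F mF tF mUF; apply: measure_semi_sigma_additive => //.
  - by move=> k; rewrite rectE.
  - by rewrite rectE.
have mT : m setT = 1.
  by rewrite -setXTT mE// pl// probability_setT.
pose mM := isMeasure.Build _ _ _ m m0 m_ge0 m_sigma.
pose mm : {measure set (X * Y) -> \bar R} := HB.pack m mM.
have [pi piE] := measure_to_probability (mT : mm setT = 1).
by exists pi => A B mA mB; rewrite piE; exact: mE.
Qed.

End bimeasure_extension.

(** * Gluing *)

Section law.
Context (R : realType) d d' (T : measurableType d) (T' : measurableType d').
Variables (P : probability T R) (f : T -> T') (mf : measurable_fun setT f).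

Definition law : probability T' R := distribution P (mfun_Sub (mem_set mf)).

Lemma lawE A : law A = P (f @^-1` A).
Proof. by []. Qed.

Lemma ge0_integral_law (g : T' -> \bar R) D : measurable D ->
  measurable_fun setT g -> (forall y, 0 <= g y)%E ->
  (\int[law]_(y in D) g y = \int[P]_(x in f @^-1` D) g (f x))%E.
Proof.
move=> mD mg g0; rewrite ge0_integral_pushforward//.
exact: measurable_funTS.
Qed.

End law.

Section rectangles.
Context (R : realType) d1 d2 (T1 : measurableType d1) (T2 : measurableType d2).

Lemma eq_measure_rectangles (P Q : probability (T1 * T2)%type R) :
  (forall A B, measurable A -> measurable B -> P (A `*` B) = Q (A `*` B)) ->
  forall C, measurable C -> P C = Q C.
Proof.
move=> PQ C mC.
apply: (measure_unique [set A `*` B | A in measurable & B in measurable]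
  (fun=> setT)) => //.
- exact: measurable_prod_measurableType.
- move=> _ _ [A mA [B mB <-]] [A' mA' [B' mB' <-]].
  exists (A `&` A'); first exact: measurableI.
  exists (B `&` B'); first exact: measurableI.
  by rewrite setXI.
- by move=> _; exists setT => //; exists setT => //; rewrite setXTT.
- by rewrite bigcup_const.
- by move=> _ [A mA [B mB <-]]; exact: PQ.
- by move=> _; rewrite ltey_eq fin_num_measure.
Qed.

End rectangles.

Section transfer.
Context (R : realType) (n : nat) d d' (W : measurableType d) (O : measurableType d').
Local Notation X := (Rn R n).
Variables (alpha : probability (X * W)%type R) (P : probability O R).
Variables (w : O -> W) (mw : measurable_fun setT w).
Hypothesis wP : forall B, measurable B -> P (w @^-1` B) = alpha (setT `*` B).
Local Open Scope ereal_scope.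

Let lam := law P mw.

(** [f A] is the conditional probability under alpha that the first coordinate
    lies in A, given the second one. *)
Let density : exists f : set X -> W -> \bar R, forall A, measurable A ->
  [/\ forall y, 0 <= f A y, lam.-integrable setT (f A) &
      forall B, measurable B -> \int[lam]_(y in B) f A y = alpha (A `*` B)].
Proof.
suff H : forall A : set X, exists f : W -> \bar R, measurable A ->
  [/\ forall y, 0 <= f y, lam.-integrable setT f &
      forall B, measurable B -> \int[lam]_(y in B) f y = alpha (A `*` B)].
  by have [f fP] := choice H; exists f.
move=> A; have [mA|nmA] := pselect (measurable A); last by exists (cst 0).
have mAT : measurable (A `*` [set: W]) by exact: measurableX.
have AToo : alpha (A `*` setT) < +oo by rewrite ltey_eq fin_num_measure.
pose a := mfrestr mAT AToo.
have aE B : measurable B -> pushforward a (@snd X W) B = alpha (A `*` B).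
  move=> mB; rewrite /pushforward /a /mfrestr /mrestr; congr (alpha _).
  by apply/seteqP; split => -[x y] /=; tauto.
have nuT : pushforward a (mfun_Sub (mem_set (@measurable_snd _ _ X W))) setT < +oo.
  by rewrite /= aE// ltey_eq fin_num_measure.
pose nu := mfrestr measurableT nuT.
have nuE B : measurable B -> nu B = alpha (A `*` B).
  by move=> mB; rewrite /nu /mfrestr /mrestr setIT /= aE.
have nulam : nu `<< lam.
  apply/null_content_dominatesP => B mB lamB.
  apply: (etrans (nuE _ mB)); apply/eqP; rewrite -measure_le0.
  have <- : alpha (setT `*` B) = 0 by rewrite -wP.
  apply: le_measure; rewrite ?inE.
  - by apply: measurableX.
  - by apply: measurableX.
  - by move=> [x y] /= [].
have [f [f0 _ fi fE]] := radon_nikodym_sigma_finite nulam.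
by exists f => _; split => // B mB; rewrite -fE//; exact: nuE.
Qed.

(** Functions with the same integrals over W agree almost everywhere, hence so do
    their compositions with w. *)
Let eq_integral_comp (f g : W -> \bar R) D : measurable D ->
  (forall y, 0 <= f y) -> (forall y, 0 <= g y) ->
  lam.-integrable setT f -> lam.-integrable setT g ->
  (forall B, measurable B -> \int[lam]_(y in B) f y = \int[lam]_(y in B) g y) ->
  \int[P]_(x in D) f (w x) = \int[P]_(x in D) g (w x).
Proof.
move=> mD f0 g0 fi gi fg.
have mf := measurable_int _ fi; have mg := measurable_int _ gi.
have : ae_eq lam setT f g by apply: integral_ae_eq => // B _; exact: fg.
move=> [N [mN N0 subN]].
have mfw : measurable_fun D (f \o w).
  by apply/measurable_funTS/measurableT_comp.
have mgw : measurable_fun D (g \o w).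
  by apply/measurable_funTS/measurableT_comp.
apply: ge0_ae_eq_integral => //.
exists (w @^-1` N); split => //.
- by rewrite -[_ @^-1` _]setTI; exact: mw.
- move=> x /= H; apply: subN => /= fgw; apply: H => _; exact: fgw.
Qed.

(** The law of w is the second marginal of alpha, so O can be enlarged by a
    variable x with (x, w) of law alpha, independent of O given w.  The joint
    law of x and O is q A D, the integral of the conditional probability of A
    over D. *)
Theorem transfer : exists G : probability (X * O)%type R,
  (forall D, measurable D -> G (setT `*` D) = P D) /\
  (forall C, measurable C -> G ((fun t => (t.1, w t.2)) @^-1` C) = alpha C).
Proof.
have [f fP] := density.
have f0 A y : measurable A -> 0 <= f A y by move=> mA; have [] := fP A mA.
have fi A : measurable A -> lam.-integrable setT (f A) by move=> mA; have [] := fP A mA.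
have fE A B : measurable A -> measurable B -> \int[lam]_(y in B) f A y = alpha (A `*` B).
  by move=> mA mB; have [_ _] := fP A mA; apply.
have mf A : measurable A -> measurable_fun setT (f A).
  by move=> mA; exact: measurable_int (fi A mA).
have mfw A : measurable A -> measurable_fun setT (fun x => f A (w x)).
  by move=> mA; apply: measurableT_comp => //; exact: mf.
have fwE A B : measurable A -> measurable B ->
    \int[P]_(x in w @^-1` B) f A (w x) = alpha (A `*` B).
  move=> mA mB; rewrite -fE// [RHS]ge0_integral_law//; first exact: mf.
  by move=> y; exact: f0.
pose q A D := \int[P]_(x in D) f A (w x).
have qfin A D : measurable A -> measurable D -> q A D \is a fin_num.
  move=> mA mD; rewrite ge0_fin_numE; last by apply: integral_ge0 => x _; exact: f0.
  apply: (@le_lt_trans _ _ (q A setT)).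
    by apply: ge0_subset_integral => //; [exact: mfw|move=> x _; exact: f0].
  rewrite /q -(preimage_setT w) fwE// ltey_eq fin_num_measure//.
  exact: measurableX.
have pB : biadditive (fun A D => fine (q A D)).
  split => [A D mA mD|A A' D mA mA' mD AA'|A D D' mA mD mD' DD'].
  - by apply/fine_ge0/integral_ge0 => x _; exact: f0.
  - rewrite -fineD ?qfin//; congr fine.
    rewrite /q -ge0_integralD//; try (by apply/measurable_funTS; exact: mfw);
      try (by move=> x _; exact: f0).
    have mAA' : measurable (A `|` A') by exact: measurableU.
    apply: (eq_integral_comp (g := f A \+ f A')) => //.
    + by move=> y; exact: f0.
    + by move=> y; apply: adde_ge0; exact: f0.
    + exact: fi.
    + by apply: integrableD => //; exact: fi.
    + move=> B mB; rewrite ge0_integralD//;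
        try (by apply/measurable_funTS; exact: mf);
        try (by move=> x _; exact: f0).
      rewrite !fE// -measureU; try exact: measurableX.
        by congr (alpha _); apply/seteqP; split => -[x y] /=; tauto.
      rewrite -setXI; move: AA'; rewrite disj_set2E => /eqP ->.
      by rewrite set0X.
  - rewrite -fineD ?qfin//; congr fine; apply: ge0_integral_setU => //.
      exact/measurable_funTS/mfw.
    by move=> x _; exact: f0.
(* the conditional probability of the whole space is 1 almost surely *)
have qT D : measurable D -> (fine (q setT D))%:E = P D.
  move=> mD; rewrite fineK ?qfin//.
  rewrite /q (eq_integral_comp (g := cst 1))//.
  - by rewrite integral_cst// mul1e.
  - by move=> y; exact: f0.
  - exact: fi.
  - by apply/finite_measure_integrable_cst.
  - by move=> B mB; rewrite fE// integral_cst// mul1e -wP.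
pose mu := law alpha (@measurable_fst _ _ X W).
have [||G GE] := @biadditive_extension R n _ O mu P (fun A D => fine (q A D)) pB.
- move=> A mA; rewrite fineK ?qfin//.
  rewrite /q -(preimage_setT w) fwE// [RHS]lawE; congr (alpha _).
  by apply/seteqP; split => -[x y] //= [].
- exact: qT.
have GT D : measurable D -> G (setT `*` D) = P D.
  by move=> mD; rewrite GE// qT.
have mtw : measurable_fun setT (fun t : X * O => (t.1, w t.2)).
  apply: measurable_fun_pair; first exact: measurable_fst.
  by apply: measurableT_comp => //; exact: measurable_snd.
exists G; split => //.
pose G' := law G mtw.
apply: (@eq_measure_rectangles _ _ _ _ _ G') => A B mA mB.
have mwB : measurable (w @^-1` B) by rewrite -[_ @^-1` _]setTI; exact: mw.
rewrite /G' [LHS]lawE (_ : _ @^-1` _ = A `*` (w @^-1` B))//.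
by rewrite GE// fineK ?qfin// /q fwE.
Qed.

End transfer.

(** * Limits of couplings along an ultrafilter *)

Section ultralimit.
Context (R : realType) (F : set_system nat) (FU : UltraFilter F).

Lemma ultra_cvg01 (u : nat -> R) : (forall k, 0 <= u k <= 1) -> cvg (u @ F).
Proof.
move=> u01; have : compact `[0 : R, 1] by exact: segment_compact.
have uU : UltraFilter (u @ F).
  split; first exact: fmap_proper_filter.
  move=> G GF FG; apply/seteqP; split => // A GA; apply: contrapT => nFA.
  have [//|FC] := in_ultra_setVsetC (u @^-1` A) FU.
  have GC : G (~` A) by exact: FG.
  by have [x []] := filter_ex (filterI GA GC).
rewrite compact_ultra => /(_ _ uU)[|l [_ ul]]; last by apply/cvg_ex; exists l.
have : F (u @^-1` `[0, 1]) by apply: filterE => k /=; rewrite in_itv/= u01.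
by [].
Qed.

End ultralimit.

Section coupling_compactness.
Context (R : realType) (n : nat) d (Y : measurableType d).
Local Notation X := (Rn R n).
Variables (mu : probability X R) (nu : probability Y R).
Variable pis : nat -> probability (X * Y)%type R.
Hypothesis pil : forall k A, measurable A -> pis k (A `*` setT) = mu A.
Hypothesis pir : forall k B, measurable B -> pis k (setT `*` B) = nu B.

(** This plays the part of weak compactness of the set of couplings.  As the
    marginals are constant along the sequence, the limit can be taken on all
    measurable rectangles, not only on continuity sets. *)
Lemma coupling_ultralimit (F : set_system nat) : UltraFilter F ->
  exists pi : probability (X * Y)%type R,
    [/\ forall A, measurable A -> pi (A `*` setT) = mu A,
        forall B, measurable B -> pi (setT `*` B) = nu B &
        forall A B, measurable A -> measurable B ->
          fine (pis k (A `*` B)) @[k --> F] --> fine (pi (A `*` B))].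
Proof.
move=> FU; pose u A B k := fine (pis k (A `*` B)).
have uE A B k : measurable A -> measurable B -> (u A B k)%:E = pis k (A `*` B).
  move=> mA mB; rewrite fineK// fin_num_measure//; exact: measurableX.
have uc A B : measurable A -> measurable B -> cvg (u A B @ F).
  move=> mA mB; apply: ultra_cvg01 => k.
  rewrite -!lee_fin uE// measure_ge0 probability_le1//; exact: measurableX.
pose p A B := lim (u A B @ F).
have up A B : measurable A -> measurable B -> u A B @ F --> p A B.
  by move=> mA mB; exact: uc.
have pE A B (l : R) : (forall k, u A B k = l) -> p A B = l.
  move=> ul; rewrite /p (_ : u A B = cst l); last exact/funext.
  by apply: cvg_lim => //; exact: cvg_cst.
have pB : biadditive p.
  split => [A B mA mB|A A' B mA mA' mB AA'|A B B' mA mB mB' BB'].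
  - apply: limr_ge; first exact: uc.
    by apply: filterE => k; rewrite fine_ge0.
  - apply: cvg_lim => //.
    rewrite (_ : u (A `|` A') B = u A B \+ u A' B); first by apply: cvgD; exact: up.
    apply/funext => k; apply: EFin_inj; rewrite /= EFinD !uE//; last exact: measurableU.
    rewrite -measureU; try exact: measurableX.
      by congr (pis k _); apply/seteqP; split => -[x y] /=; tauto.
    rewrite -setXI; move: AA'; rewrite disj_set2E => /eqP ->.
    by rewrite set0X.
  - apply: cvg_lim => //.
    rewrite (_ : u A (B `|` B') = u A B \+ u A B'); first by apply: cvgD; exact: up.
    apply/funext => k; apply: EFin_inj; rewrite /= EFinD !uE//; last exact: measurableU.
    rewrite -measureU; try exact: measurableX.
      by congr (pis k _); apply/seteqP; split => -[x y] /=; tauto.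
    rewrite -setXI; move: BB'; rewrite disj_set2E => /eqP ->.
    by rewrite setX0.
have pl A : measurable A -> (p A setT)%:E = mu A.
  move=> mA; rewrite (@pE _ _ (fine (mu A))); first by rewrite fineK// fin_num_measure.
  by move=> k; rewrite /u pil.
have pr B : measurable B -> (p setT B)%:E = nu B.
  move=> mB; rewrite (@pE _ _ (fine (nu B))); first by rewrite fineK// fin_num_measure.
  by move=> k; rewrite /u pir.
have [pi piE] := biadditive_extension pB pl pr.
exists pi; split => [A mA|B mB|A B mA mB]; rewrite piE//.
- exact: pl.
- exact: pr.
- exact: up.
Qed.

End coupling_compactness.

(** * Step functions on rectangles *)
Section finite_partition.
Context (R : realType) d1 d2 (X : measurableType d1) (Y : measurableType d2).
Variables (I : finType) (u : X -> I) (v : Y -> I) (C : I -> I -> R).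
Hypothesis mu : forall i, measurable (u @^-1` [set i]).
Hypothesis mv : forall i, measurable (v @^-1` [set i]).
Hypothesis C0 : forall i j, 0 <= C i j.

Let stepE z : C (u z.1) (v z.2) = \sum_(ij : I * I)
  C ij.1 ij.2 * \1_((u @^-1` [set ij.1]) `*` (v @^-1` [set ij.2])) z.
Proof.
rewrite (bigD1 (u z.1, v z.2))//= big1 ?addr0.
  by rewrite indicE mem_set ?mulr1//; split.
move=> [i j] /= ij; rewrite indicE memNset ?mulr0// => -[/= ui vj].
by rewrite -ui -vj eqxx in ij.
Qed.

Let mrect i j : measurable ((u @^-1` [set i]) `*` (v @^-1` [set j])).
Proof. exact: measurableX. Qed.

Let mterm ij : measurable_fun setT (fun z : X * Y =>
  C ij.1 ij.2 * \1_((u @^-1` [set ij.1]) `*` (v @^-1` [set ij.2])) z).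
Proof. by apply: measurable_funM => //; exact: measurable_indic. Qed.

Lemma measurable_step : measurable_fun setT (fun z : X * Y => C (u z.1) (v z.2)).
Proof.
rewrite (eq_fun stepE); apply: measurable_sum => ij; exact: mterm.
Qed.

Lemma integral_step (pi : probability (X * Y)%type R) :
  (\int[pi]_z (C (u z.1) (v z.2))%:E =
   (\sum_(ij : I * I) C ij.1 ij.2 *
      fine (pi ((u @^-1` [set ij.1]) `*` (v @^-1` [set ij.2]))))%:E)%E.
Proof.
under eq_integral do rewrite stepE -sumEFin.
rewrite ge0_integral_sum//; last 2 first.
- by move=> ij; apply/measurable_EFinP; exact: mterm.
- by move=> ij z _; rewrite lee_fin mulr_ge0.
rewrite -sumEFin; apply: eq_bigr => ij _.
under eq_integral do rewrite EFinM.
rewrite ge0_integralZl_EFin//; last first.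
  by apply/measurable_EFinP; exact: measurable_indic.
by rewrite integral_indic// setIT EFinM fineK// fin_num_measure.
Qed.

End finite_partition.

(** * Approximating (a - b)^2 from below on a grid *)

Section grid.
Context (R : realType).
Implicit Types (a b : R) (j k : nat).

Definition clamp (M a : R) : R := Num.min M (Num.max 0 a).

Lemma clamp_lip M a b : 0 <= M -> `|clamp M a - clamp M b| <= `|a - b|.
Proof.
move=> M0; have := ler_norm (a - b); have := ler_norm (b - a).
rewrite (distrC b a) => ba ab; rewrite ler_norml /clamp.
rewrite /Order.min /Order.max.
case: (ltP 0 a) => ?; case: (ltP 0 b) => ?; case: (ltP M 0) => ?;
  case: (ltP M a) => ?; case: (ltP M b) => ?; apply/andP; split; lra.
Qed.

Lemma clamp_itv M a : 0 <= M -> 0 <= clamp M a <= M.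
Proof.
by move=> M0; rewrite /clamp ge_min lexx le_min M0 le_max lexx.
Qed.

Lemma clamp_id M a : 0 <= a <= M -> clamp M a = a.
Proof. by move=> /andP[a0 aM]; rewrite /clamp (max_idPr a0) (min_idPr aM). Qed.

(** With J = j+1, the interval [-J, J] is cut into 2 J^2 cells of length 1/J, and
    [grid_pos] is the position of a in units of a cell.  Clamping, being
    1-Lipschitz, keeps the lower bound [grid_sqdist_le] valid outside of the
    interval, with finitely many cells. *)
Definition grid_size j : nat := (2 * j.+1 ^ 2)%N.

Definition grid_pos j a : R := clamp (grid_size j)%:R ((a + j.+1%:R) * j.+1%:R).

Definition grid_cell j a : 'I_(grid_size j).+1 := inord (Num.truncn (grid_pos j a)).

Lemma grid_cellP j a :
  (grid_cell j a)%:R <= grid_pos j a < (grid_cell j a)%:R + 1.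
Proof.
have /andP[t0 tN] := clamp_itv ((a + j.+1%:R) * j.+1%:R) (ler0n R (grid_size j)).
rewrite /grid_cell inordK; last by rewrite ltnS -(ler_nat R) (le_trans _ tN)// truncn_le.
by have := truncn_itv t0; rewrite -[(Num.truncn _).+1%:R]natr1.
Qed.

Lemma measurable_grid_cell j (k : 'I_(grid_size j).+1) :
  measurable (grid_cell j @^-1` [set k]).
Proof.
rewrite (_ : _ @^-1` _ = grid_pos j @^-1` `[k%:R, k%:R + 1[).
  rewrite -[X in measurable X]setTI.
  have mg : measurable_fun setT (grid_pos j).
    apply: measurable_minr; first exact: measurable_cst.
    apply: measurable_maxr; first exact: measurable_cst.
    by apply: measurable_funM => //; exact: measurable_funD.
  by apply: mg => //; exact: measurable_itv.
apply/seteqP; split => a /=; rewrite in_itv/=.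
  by move=> <-; exact: grid_cellP.
move=> /andP[ka ak]; have /andP[ca ac] := grid_cellP j a.
have lt1 (m l : nat) (x : R) : m%:R <= x -> x < l%:R + 1 -> (m <= l)%N.
  by move=> mx xl; rewrite -ltnS -(ltr_nat R) -natr1 (le_lt_trans mx).
by apply/val_inj/eqP; rewrite /= eqn_leq (lt1 _ _ _ ca)//= (lt1 _ _ _ ka).
Qed.

(** Points of the cells k and l are at distance at least (|k - l| - 1) / J. *)
Definition grid_sqdist j (k l : nat) : R :=
  (Num.max 0 (`|k%:R - l%:R| - 1) / j.+1%:R) ^+ 2.

Lemma grid_sqdist_ge0 j k l : 0 <= grid_sqdist j k l.
Proof. exact: sqr_ge0. Qed.

Let h j a b : R := Num.max 0 (`|(grid_cell j a)%:R - (grid_cell j b)%:R| - 1) / j.+1%:R.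

Let h_ge0 j a b : 0 <= h j a b.
Proof. by rewrite divr_ge0// le_max lexx. Qed.

Let h_le j a b : h j a b <= `|a - b|.
Proof.
have J0 : 0 < j.+1%:R :> R by rewrite ltr0n.
rewrite ler_pdivrMr// ge_max mulr_ge0//=.
have := clamp_lip ((a + j.+1%:R) * j.+1%:R) ((b + j.+1%:R) * j.+1%:R)
  (ler0n R (grid_size j)).
rewrite -/(grid_pos j a) -/(grid_pos j b).
rewrite (_ : _ - _ * _ = (a - b) * j.+1%:R); last by ring.
rewrite normrM (ger0_norm (ltW J0)); set D := `|a - b| * _ => H.
have := grid_cellP j a; have := grid_cellP j b => /andP[b1 b2] /andP[a1 a2].
rewrite lerBlDr ler_norml; move: H; rewrite ler_norml => /andP[H1 H2].
by apply/andP; split; lra.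
Qed.

Lemma grid_sqdist_le j a b :
  grid_sqdist j (grid_cell j a) (grid_cell j b) <= (a - b) ^+ 2.
Proof.
rewrite -[leRHS]real_normK ?num_real// /grid_sqdist.
by rewrite lerXn2r ?nnegrE//; exact: h_le.
Qed.

Let grid_pos_id j a : `|a| <= j.+1%:R ->
  grid_pos j a = (a + j.+1%:R) * j.+1%:R.
Proof.
have -> : grid_pos j a = clamp (2 * j.+1%:R * j.+1%:R) ((a + j.+1%:R) * j.+1%:R).
  by rewrite /grid_pos /grid_size natrM natrX expr2 mulrA.
have : 0 <= j.+1%:R :> R by exact: ler0n.
move: (j.+1%:R : R) => J J0; rewrite ler_norml => /andP[aJ Ja]; apply: clamp_id.
by apply/andP; split; [apply: mulr_ge0|apply: ler_wpM2r] => //; lra.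
Qed.

(** Two points of [-J, J] in the cells k and l are at distance at most
    (|k - l| + 1) / J. *)
Let h_ge j a b : `|a| <= j.+1%:R -> `|b| <= j.+1%:R ->
  `|a - b| - 2 * j.+1%:R^-1 <= h j a b.
Proof.
move=> aJ bJ; have J0 : 0 < j.+1%:R :> R by rewrite ltr0n.
rewrite ler_pdivlMr// le_max; apply/orP; right.
have := grid_cellP j a; have := grid_cellP j b.
rewrite !grid_pos_id//.
set k := (grid_cell j a)%:R; set l := (grid_cell j b)%:R => /andP[l1 l2] /andP[k1 k2].
rewrite mulrBl -mulrA mulVf ?gt_eqF// mulr1.
rewrite -[X in _ * X - _](ger0_norm (ltW J0)) -normrM.
rewrite (_ : (a - b) * _ =
  (a + j.+1%:R) * j.+1%:R - (b + j.+1%:R) * j.+1%:R); last by ring.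
rewrite lerBlDr ler_norml.
have := ler_norm (k - l); have := ler_norm (l - k); rewrite (distrC l k) => ? ?.
by apply/andP; split; lra.
Qed.

Lemma grid_sqdist_cvg a b :
  grid_sqdist j (grid_cell j a) (grid_cell j b) @[j --> \oo] --> (a - b) ^+ 2.
Proof.
rewrite -[X in _ --> X](real_normK (num_real _)).
suff H : h j a b @[j --> \oo] --> `|a - b| by rewrite expr2; exact: cvgM.
have L : (`|a - b| - 2 * j.+1%:R^-1 : R) @[j --> \oo] --> `|a - b|.
  rewrite -[X in _ --> X]subr0 -[X in _ --> _ - X](mulr0 (2 : R)).
  apply: cvgB; first exact: cvg_cst.
  by apply: cvgMl_tmp; exact: cvg_harmonic.
apply: (squeeze_cvgr _ L (cvg_cst _)); near=> j.
rewrite h_le andbT; apply: h_ge.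
- near: j; have [N _ NP] := nbhs_infty_ger `|a|; exists N => // j /NP /= aj.
  by rewrite (le_trans aj)// ler_nat.
- near: j; have [N _ NP] := nbhs_infty_ger `|b|; exists N => // j /NP /= bj.
  by rewrite (le_trans bj)// ler_nat.
Unshelve. all: by end_near. Qed.

End grid.

(** * Existence of optimal couplings *)

Section optimal_coupling.
Context (R : realType) (n : nat).
Local Notation X := (Rn R n).
Local Open Scope ereal_scope.

Lemma preimage_fst (T1 T2 : Type) (A : set T1) :
  (@fst T1 T2) @^-1` A = A `*` setT.
Proof. by apply/seteqP; split => -[x y] //= []. Qed.

Lemma preimage_snd (T1 T2 : Type) (B : set T2) :
  (@snd T1 T2) @^-1` B = setT `*` B.
Proof. by apply/seteqP; split => -[x y] //= []. Qed.

Lemma sqnorm_ge0 (x : 'rV[R]_n) : (0 <= sqnorm x)%R.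
Proof. by apply: sumr_ge0 => i _; exact: sqr_ge0. Qed.

Lemma measurable_sqdist d (T : measurableType d) (f g : T -> X) :
  measurable_fun setT f -> measurable_fun setT g ->
  measurable_fun setT
    (fun t => (sqnorm ((f t : 'rV[R]_n) - (g t : 'rV[R]_n)))%:E).
Proof.
move=> mf mg; apply/measurable_EFinP; apply: measurable_sum => i.
apply: (eq_measurable_fun (fun t => ((f t : 'rV[R]_n) ord0 i -
    (g t : 'rV[R]_n) ord0 i) ^+ 2)%R); first by move=> t _; rewrite !mxE.
apply: measurable_funX; apply: measurable_funB.
- exact: (measurableT_comp (measurable_coord i) mf).
- exact: (measurableT_comp (measurable_coord i) mg).
Qed.

Lemma cvg_sumr (T I : Type) (F : set_system T) (FF : Filter F) (r : seq I)
    (f : I -> T -> R) (l : I -> R) :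
  (forall i, f i @ F --> l i) ->
  (\sum_(i <- r) f i t)%R @[t --> F] --> (\sum_(i <- r) l i)%R.
Proof.
move=> fl; elim: r => [|i r IH].
  by rewrite big_nil; under eq_fun do rewrite big_nil; exact: cvg_cst.
by rewrite big_cons; under eq_fun do rewrite big_cons; exact: cvgD.
Qed.

Lemma limn_einf_le (u : nat -> \bar R) (m : \bar R) :
  (forall j, u j <= m) -> limn_einf u <= m.
Proof.
move=> um; rewrite limn_einf_lim; apply: lime_le; first exact: is_cvg_einfs.
by apply: nearW => j; apply: le_trans (um j); apply: ereal_inf_lbound; exists j => /=.
Qed.

Definition grid_box j (x : X) : {ffun 'I_n -> 'I_(grid_size j).+1} :=
  [ffun i => grid_cell j ((x : 'rV[R]_n) ord0 i)].

Definition grid_cost j (f g : {ffun 'I_n -> 'I_(grid_size j).+1}) : R :=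
  (\sum_(i < n) grid_sqdist R j (f i) (g i))%R.

Lemma grid_cost_ge0 j f g : (0 <= grid_cost (j := j) f g)%R.
Proof. by apply: sumr_ge0 => i _; exact: grid_sqdist_ge0. Qed.

Lemma grid_cost_le j (x y : X) :
  (grid_cost (grid_box j x) (grid_box j y) <=
   sqnorm ((x : 'rV[R]_n) - (y : 'rV[R]_n)))%R.
Proof.
by apply: ler_sum => i _; rewrite !ffunE !mxE; exact: grid_sqdist_le.
Qed.

Lemma grid_cost_cvg (x y : X) :
  grid_cost (grid_box j x) (grid_box j y) @[j --> \oo] -->
  sqnorm ((x : 'rV[R]_n) - (y : 'rV[R]_n)).
Proof.
rewrite /grid_cost /sqnorm; apply: cvg_sumr => i.
by under eq_fun do rewrite !ffunE; rewrite !mxE; exact: grid_sqdist_cvg.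
Qed.

Lemma measurable_grid_box j f : measurable (grid_box j @^-1` [set f]).
Proof.
rewrite (_ : _ @^-1` _ = \bigcap_(i in [set: 'I_n])
    ((fun x : X => (x : 'rV[R]_n) ord0 i) @^-1` (grid_cell j @^-1` [set f i]))).
  apply: fin_bigcap_measurable => // i _; rewrite -[X in measurable X]setTI.
  by apply: measurable_coord => //; exact: measurable_grid_cell.
apply/seteqP; split => x /=; first by move=> <- i _ /=; rewrite ffunE.
by move=> xf; apply/ffunP => i; rewrite ffunE; exact: xf.
Qed.

(** The integral of a grid cost is a finite combination of measures of
    rectangles, so it passes to the limit and is bounded by m for pi as well;
    the grid costs converge to the cost from below, and Fatou's lemma
    concludes.  Stated with m + e instead of a limit of the costs because this
    is what a minimizing sequence provides. *)
Lemma lsc_transport_cost (pis : nat -> probability (X * X)%type R)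
    (F : set_system nat) (FF : ProperFilter F) (pi : probability (X * X)%type R)
    (m : R) :
  (forall A B, measurable A -> measurable B ->
     fine (pis k (A `*` B)) @[k --> F] --> fine (pi (A `*` B))) ->
  (forall e : R, (0 < e)%R -> \forall k \near F, transport_cost (pis k) <= (m + e)%:E) ->
  transport_cost pi <= m%:E.
Proof.
move=> pis_pi pis_m.
have mbox j f := @measurable_grid_box j f.
have step j (P : probability (X * X)%type R) :=
  integral_step (mbox j) (mbox j) (@grid_cost_ge0 j) P.
pose Box j := {ffun 'I_n -> 'I_(grid_size j).+1}.
have le_m j : \int[pi]_z (grid_cost (grid_box j z.1) (grid_box j z.2))%:E <= m%:E.
  rewrite step lee_fin; apply/ler_addgt0Pr => e e0.
  pose u k := (\sum_(ij : Box j * Box j)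
     grid_cost ij.1 ij.2 *
      fine (pis k ((grid_box j @^-1` [set ij.1]) `*`
                   (grid_box j @^-1` [set ij.2]))))%R.
  have upi : u @ F --> (\sum_(ij : Box j * Box j)
     grid_cost ij.1 ij.2 *
      fine (pi ((grid_box j @^-1` [set ij.1]) `*`
                (grid_box j @^-1` [set ij.2]))))%R.
    by apply: cvg_sumr => ij; apply: cvgMl_tmp; exact: pis_pi.
  apply: (cvgr_to_le upi); apply: filterS (pis_m e e0) => k.
  rewrite -lee_fin; apply: le_trans.
  rewrite /u -step; apply: ge0_le_integral => //.
  - by move=> z _; rewrite lee_fin grid_cost_ge0.
  - by apply/measurable_EFinP; exact: (measurable_step (@grid_cost j) (mbox j) (mbox j)).
  - exact: (measurable_sqdist measurable_fst measurable_snd).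
  - by move=> z _; rewrite lee_fin; exact: grid_cost_le.
apply: (@le_trans _ _ (\int[pi]_z
    limn_einf (fun j => (grid_cost (grid_box j z.1) (grid_box j z.2))%:E))).
  rewrite le_eqVlt; apply/orP; left; apply/eqP; apply: eq_integral => z _.
  apply/esym; apply: (cvg_limn_einf_sup _).1.
  by apply: cvg_EFin; [exact: nearW|exact: grid_cost_cvg].
apply: le_trans (fatou _ _ _ _) _ => //.
- move=> j; apply/measurable_EFinP.
  exact: (measurable_step (@grid_cost j) (mbox j) (mbox j)).
- by move=> j z _; rewrite lee_fin grid_cost_ge0.
- exact: limn_einf_le.
Qed.

(** An ultrafilter limit of a minimizing sequence is optimal by lower
    semicontinuity.  If the infimum is infinite, then every coupling attains
    it. *)
Theorem optimal_coupling (mu nu : probability X R) :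
  exists2 pi, couplings mu nu pi & transport_cost pi =
    ereal_inf [set transport_cost pi' | pi' in couplings mu nu].
Proof.
set S := [set _ | _ in _]; set m := ereal_inf S.
have S0 : S !=set0.
  exists (transport_cost (mu \x nu : probability _ R)).
  exists (mu \x nu : probability _ R) => //.
  split=> [A mA|B mB].
  - rewrite preimage_fst; apply: (etrans (product_measure1E mu nu mA measurableT)).
    by rewrite [X in _ * X](probability_setT nu) mule1.
  - rewrite preimage_snd; apply: (etrans (product_measure1E mu nu measurableT mB)).
    by rewrite [X in X * _](probability_setT mu) mul1e.
have m_ge0 : 0 <= m.
  apply: le_ereal_inf_tmp => _ [pi _ <-]; apply: integral_ge0 => z _.
  by rewrite lee_fin sqnorm_ge0.
have m_le pi : couplings mu nu pi -> m <= transport_cost pi.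
  by move=> cpi; apply: ereal_inf_lbound; exists pi.
have [moo|mfin] := eqVneq m +oo.
  have [_ [pi cpi _]] := S0; exists pi => //.
  by apply/eqP; rewrite eq_le m_le// andbT moo leey.
have {}mfin : m \is a fin_num by rewrite ge0_fin_numE// lt_neqAle mfin leey.
have /choice[pis pisP] : forall k : nat, exists pi, couplings mu nu pi /\
    transport_cost pi < m + (k.+1%:R^-1)%:E.
  move=> k; have k0 : (0 < k.+1%:R^-1 :> R)%R by rewrite invr_gt0.
  by have [_ [pi cpi <-] pim] := lb_ereal_inf_adherent k0 mfin; exists pi.
have [F [FU oF]] := ultraFilterLemma (eventually_filter : ProperFilter \oo).
have [||pi [pil pir pis_pi]] := @coupling_ultralimit R n _ X mu nu pis _ _ F FU.
- by move=> k A mA; have [[+ _] _] := pisP k => /(_ A mA); rewrite preimage_fst.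
- by move=> k B mB; have [[_ +] _] := pisP k => /(_ B mB); rewrite preimage_snd.
have cpi : couplings mu nu pi.
  by split=> [A mA|B mB]; rewrite ?preimage_fst ?preimage_snd; [exact: pil|exact: pir].
exists pi => //; apply/eqP; rewrite eq_le m_le// andbT.
suff : transport_cost pi <= (fine m)%:E by rewrite fineK.
apply: (@lsc_transport_cost pis F ultra_proper pi (fine m) pis_pi) => e e0.
apply: oF; have [N _ NP] := near_infty_natSinv_lt (PosNum e0).
exists N => // k /NP /= ke; apply: ltW; apply: (lt_trans (pisP k).2).
by rewrite EFinD fineK// lteD2lE// lte_fin.
Qed.

End optimal_coupling.

(** * The squared Wasserstein distance *)

Section integral_of_law.
Local Open Scope ereal_scope.

Lemma integral_eq_law (R : realType) d d' (T : measurableType d)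
    (T' : measurableType d') (P : probability T R) (Q : probability T' R)
    (f : T -> T') (g : T' -> \bar R) : measurable_fun setT f ->
  (forall A, measurable A -> P (f @^-1` A) = Q A) ->
  measurable_fun setT g -> (forall y, 0 <= g y) ->
  \int[Q]_y g y = \int[P]_x g (f x).
Proof.
move=> mf PQ mg g0.
rewrite -[RHS](ge0_integral_law P mf measurableT mg g0).
by apply: eq_measure_integral => A mA _; exact/esym/PQ.
Qed.

Lemma measurable_sqnorm (R : realType) n :
  measurable_fun setT (fun x : Rn R n => (sqnorm (x : 'rV[R]_n))%:E).
Proof.
apply/measurable_EFinP; apply: measurable_sum => i.
by apply: measurable_funX; exact: measurable_coord.
Qed.

Lemma ge0_integral_comb (R : realType) d (T : measurableType d)
    (P : {measure set T -> \bar R}) (a b c : T -> R) (p q : R) :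
  measurable_fun setT (EFin \o a) -> measurable_fun setT (EFin \o b) ->
  measurable_fun setT (EFin \o c) ->
  (forall t, 0 <= a t)%R -> (forall t, 0 <= b t)%R -> (forall t, 0 <= c t)%R ->
  (0 <= p)%R -> (0 <= q)%R ->
  \int[P]_t (a t + (p * b t + q * c t))%:E =
  \int[P]_t (a t)%:E + (p%:E * \int[P]_t (b t)%:E + q%:E * \int[P]_t (c t)%:E).
Proof.
move=> ma mb mc a0 b0 c0 p0 q0.
have mZ (r : R) (f : T -> R) : measurable_fun setT (EFin \o f) ->
    measurable_fun setT (fun t => r%:E * (f t)%:E).
  by move=> mf; exact: measurable_funeM.
have Z0 (r : R) (f : T -> R) t : (0 <= r)%R -> (forall t, 0 <= f t)%R ->
    0 <= r%:E * (f t)%:E.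
  by move=> r0 f0; rewrite mule_ge0// lee_fin.
have Z (r : R) (f : T -> R) : measurable_fun setT (EFin \o f) ->
    (0 <= r)%R -> (forall t, 0 <= f t)%R ->
    r%:E * \int[P]_t (f t)%:E = \int[P]_t (r%:E * (f t)%:E).
  by move=> mf r0 f0; rewrite ge0_integralZl_EFin// => t _; rewrite lee_fin.
rewrite (Z p b)// (Z q c)// -ge0_integralD//; last 4 first.
- by move=> t _; exact: Z0.
- exact: mZ.
- by move=> t _; exact: Z0.
- exact: mZ.
rewrite -ge0_integralD//; last 3 first.
- by move=> t _; rewrite lee_fin.
- by move=> t _; rewrite adde_ge0// Z0.
- by apply: emeasurable_funD; exact: mZ.
Qed.

End integral_of_law.

Section wasserstein.
Context (R : realType) (n : nat).
Local Notation X := (Rn R n).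
Implicit Types mu nu : P2 R n.
Local Open Scope ereal_scope.

Lemma sqnormB_le (x y : 'rV[R]_n) :
  (sqnorm (x - y) <= 2 * sqnorm x + 2 * sqnorm y)%R.
Proof.
rewrite /sqnorm !mulr_sumr -big_split/=; apply: ler_sum => i _.
rewrite !mxE; have := sqr_ge0 (x ord0 i + y ord0 i); lra.
Qed.

Lemma coupling_integral (mu nu : probability X R)
    (pi : probability (X * X)%type R) (f : X -> \bar R) :
  couplings mu nu pi -> measurable_fun setT f -> (forall x, 0 <= f x) ->
  \int[pi]_z f z.1 = \int[mu]_x f x /\ \int[pi]_z f z.2 = \int[nu]_x f x.
Proof.
move=> [pil pir] mf f0.
by split; apply/esym; apply: integral_eq_law.
Qed.

Lemma transport_cost_fin mu nu (pi : probability (X * X)%type R) :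
  couplings mu nu pi -> transport_cost pi \is a fin_num.
Proof.
move=> cpi.
have msq := @measurable_sqnorm R n.
have sq0 (x : X) : 0 <= (sqnorm (x : 'rV[R]_n))%:E by rewrite lee_fin sqnorm_ge0.
have [E1 E2] := coupling_integral cpi msq sq0.
have m1 : measurable_fun setT (fun z : X * X => (sqnorm (z.1 : 'rV[R]_n))%:E).
  exact: (measurableT_comp msq measurable_fst).
have m2 : measurable_fun setT (fun z : X * X => (sqnorm (z.2 : 'rV[R]_n))%:E).
  exact: (measurableT_comp msq measurable_snd).
rewrite ge0_fin_numE; last by apply: integral_ge0 => z _; rewrite lee_fin sqnorm_ge0.
apply: (@le_lt_trans _ _ (\int[pi]_z (2%:E * (sqnorm (z.1 : 'rV[R]_n))%:E +
    2%:E * (sqnorm (z.2 : 'rV[R]_n))%:E))).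
  apply: ge0_le_integral => //.
  - exact: (measurable_sqdist measurable_fst measurable_snd).
  - by apply: emeasurable_funD; apply: measurable_funeM.
  - by move=> z _; rewrite -!EFinM -EFinD lee_fin sqnormB_le.
rewrite ge0_integralD//; last 4 first.
- by move=> z _; rewrite mule_ge0.
- exact: measurable_funeM.
- by move=> z _; rewrite mule_ge0.
- exact: measurable_funeM.
rewrite !ge0_integralZl_EFin// E1 E2.
by apply: lte_add_pinfty; apply: lte_mul_pinfty => //; exact: P2_moment.
Qed.

Lemma W2sq_optimal mu nu :
  exists2 pi, couplings mu nu pi & (W2sq mu nu)%:E = transport_cost pi.
Proof.
have [pi cpi piE] := optimal_coupling mu nu.
by exists pi => //; rewrite /W2sq -piE fineK// (transport_cost_fin cpi).
Qed.

Lemma W2sq_le mu nu (pi : probability (X * X)%type R) : couplings mu nu pi ->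
  (W2sq mu nu)%:E <= transport_cost pi.
Proof.
move=> cpi; have [pi' cpi' piE] := optimal_coupling mu nu.
rewrite /W2sq -piE fineK ?(transport_cost_fin cpi')// piE.
by apply: ereal_inf_lbound; exists pi.
Qed.

Lemma transport_cost_law d (T : measurableType d) (P : probability T R)
    (f g : T -> X) (pi : probability (X * X)%type R) :
  measurable_fun setT f -> measurable_fun setT g ->
  (forall C, measurable C -> P ((fun t => (f t, g t)) @^-1` C) = pi C) ->
  transport_cost pi = \int[P]_t (sqnorm ((f t : 'rV[R]_n) - (g t : 'rV[R]_n)))%:E.
Proof.
move=> mf mg Ppi; rewrite /transport_cost.
rewrite (integral_eq_law (measurable_fun_pair mf mg) Ppi) //.
- exact: (measurable_sqdist measurable_fst measurable_snd).
- by move=> z; rewrite lee_fin sqnorm_ge0.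
Qed.

Lemma W2sq_le_law mu nu d (T : measurableType d) (P : probability T R)
    (f g : T -> X) :
  measurable_fun setT f -> measurable_fun setT g ->
  (forall A, measurable A -> P (f @^-1` A) = mu A) ->
  (forall B, measurable B -> P (g @^-1` B) = nu B) ->
  (W2sq mu nu)%:E <= \int[P]_t (sqnorm ((f t : 'rV[R]_n) - (g t : 'rV[R]_n)))%:E.
Proof.
move=> mf mg Pmu Pnu.
rewrite -(@transport_cost_law _ _ P f g (law P (measurable_fun_pair mf mg)))//.
by apply: W2sq_le; split=> A mA; rewrite lawE; [exact: Pmu|exact: Pnu].
Qed.

End wasserstein.

(** * Generalized geodesics *)
Section generalized_geodesic.
Context (R : realType) (n : nat).
Local Notation X := (Rn R n).

(** The argument is (x1, (x0, y)): gluing adjoins the new variable on the left,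
    and x1 is glued onto the optimal coupling (x0, y). *)
Definition interpolate (s : R) (t : X * (X * X)) : X :=
  ((1 - s) *: (t.2.1 : 'rV[R]_n) + s *: (t.1 : 'rV[R]_n) : 'rV[R]_n).

Lemma measurable_interpolate s : measurable_fun setT (interpolate s).
Proof.
apply: measurable_coordP => i.
apply: (eq_measurable_fun (fun t : X * (X * X) =>
  (1 - s) * (t.2.1 : 'rV[R]_n) ord0 i + s * (t.1 : 'rV[R]_n) ord0 i)).
  by move=> t _; rewrite !mxE.
have m1 : measurable_fun setT (fun t : X * (X * X) => t.2.1).
  exact: (measurableT_comp measurable_fst measurable_snd).
apply: measurable_funD; apply: measurable_funM => //.
- exact: (measurableT_comp (measurable_coord i) m1).
- exact: (measurableT_comp (measurable_coord i) measurable_fst).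
Qed.

Lemma sqnorm_interpolate_le s (x0 x1 : 'rV[R]_n) : 0 <= s <= 1 ->
  sqnorm ((1 - s) *: x0 + s *: x1) <= sqnorm x0 + sqnorm x1.
Proof.
move=> /andP[s0 s1]; rewrite /sqnorm -big_split/=; apply: ler_sum => i _.
rewrite !mxE; move: (x0 _ _) (x1 _ _) => a b.
have s10 : 0 <= 1 - s by rewrite subr_ge0.
have h1 := mulr_ge0 (mulr_ge0 s0 s10) (sqr_ge0 (a - b)).
have h2 := mulr_ge0 s0 (sqr_ge0 a).
have h3 := mulr_ge0 s10 (sqr_ge0 b).
rewrite -subr_ge0.
rewrite (_ : _ - _ = s * (1 - s) * (a - b) ^+ 2 + s * a ^+ 2 + (1 - s) * b ^+ 2).
  by rewrite !addr_ge0.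
ring.
Qed.

(** Affinity of |x - y|^2 - |x - z|^2 in x, with all terms nonnegative and no
    subtraction of squared norms, so that it can be integrated termwise. *)
Lemma sqnorm_interpolate_sub s (x0 x1 y z : 'rV[R]_n) :
  sqnorm (((1 - s) *: x0 + s *: x1) - y) +
    ((1 - s) * sqnorm (x0 - z) + s * sqnorm (x1 - z)) =
  sqnorm (((1 - s) *: x0 + s *: x1) - z) +
    ((1 - s) * sqnorm (x0 - y) + s * sqnorm (x1 - y)).
Proof.
rewrite /sqnorm !mulr_sumr -!big_split/=; apply: eq_bigr => i _.
rewrite !mxE; ring.
Qed.

(** The point [mus] is built from the optimal couplings with nubar only, before
    any competitor nu is given; each nu is then glued on separately. *)
Lemma exists_segment_point (mu0 mu1 nubar : P2 R n) (s : R) : 0 < s < 1 ->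
  exists mus : P2 R n, forall nu : P2 R n,
    W2sq mus nubar - W2sq mus nu <=
    (1 - s) * (W2sq mu0 nubar - W2sq mu0 nu) + s * (W2sq mu1 nubar - W2sq mu1 nu).
Proof.
move=> /andP[s0 s1]; have s10 : 0 <= 1 - s by rewrite subr_ge0 ltW.
have [pi0 [pi0l pi0r] pi0E] := W2sq_optimal mu0 nubar.
have [pi1 [pi1l pi1r] pi1E] := W2sq_optimal mu1 nubar.
have [|G [G0 G1]] := @transfer R n _ _ X (X * X)%type pi1 pi0 snd measurable_snd.
  by move=> B mB; rewrite pi0r// -pi1r// preimage_snd.
have mT := measurable_interpolate s.
have msq := @measurable_sqnorm R n.
have sq0 (x : X) : (0 <= (sqnorm (x : 'rV[R]_n))%:E)%E by rewrite lee_fin sqnorm_ge0.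
(* G is the joint law of (x1, (x0, y)) *)
have Gx0 A : measurable A -> G ((fun t : X * (X * X) => t.2.1) @^-1` A) = mu0 A.
  move=> mA; rewrite -pi0l// -G0; last first.
    by rewrite -[_ @^-1` _]setTI; exact: measurable_fst.
  by congr (G _); apply/seteqP; split => -[a [b c]] //= [].
have Gx1 A : measurable A -> G ((fun t : X * (X * X) => t.1) @^-1` A) = mu1 A.
  move=> mA; rewrite -pi1l// -G1//.
  by rewrite -[_ @^-1` _]setTI; exact: measurable_fst.
have mx0 : measurable_fun setT (fun t : X * (X * X) => t.2.1).
  exact: (measurableT_comp measurable_fst measurable_snd).
have mx1 : measurable_fun setT (fun t : X * (X * X) => t.1) by exact: measurable_fst.
have moment : (\int[law G mT]_x (sqnorm (x : 'rV[R]_n))%:E < +oo)%E.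
  rewrite ge0_integral_law// preimage_setT.
  apply: (@le_lt_trans _ _ (\int[G]_t ((sqnorm (t.2.1 : 'rV[R]_n))%:E +
      (sqnorm (t.1 : 'rV[R]_n))%:E))%E).
    apply: ge0_le_integral => //.
    - exact: (measurableT_comp msq mT).
    - by apply: emeasurable_funD; [exact: (measurableT_comp msq mx0)|
        exact: (measurableT_comp msq mx1)].
    - by move=> t _; rewrite -EFinD lee_fin sqnorm_interpolate_le// ltW//= ltW.
  rewrite ge0_integralD//; [|exact: (measurableT_comp msq mx0)|
    exact: (measurableT_comp msq mx1)].
  rewrite -(integral_eq_law mx0 Gx0 msq sq0) -(integral_eq_law mx1 Gx1 msq sq0).
  by apply: lte_add_pinfty; exact: P2_moment.
exists (MkP2 moment) => nu; set mus := MkP2 moment.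
have [sg [sgl sgr] sgE] := W2sq_optimal mus nu.
(* gluing adjoins the first coordinate, whereas z is the second one of sg *)
pose swap (z : X * X) := (z.2, z.1).
have mswap : measurable_fun setT swap.
  exact: (measurable_fun_pair measurable_snd measurable_fst).
have [|H [H0 H1]] := @transfer R n _ _ X (X * (X * X))%type (law sg mswap) G _ mT.
  move=> B mB; rewrite [RHS]lawE; transitivity (mus B); first by [].
  rewrite -sgl//; by congr (sg _); apply/seteqP; split => -[a b] //= [].
(* H is the joint law of (z, (x1, (x0, y))) *)
pose Om := (X * (X * (X * X)))%type.
pose z (t : Om) : X := t.1.
pose x1 (t : Om) : X := t.2.1.
pose x0 (t : Om) : X := t.2.2.1.
pose y (t : Om) : X := t.2.2.2.
pose xs (t : Om) : X := interpolate s t.2.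
have m2 : measurable_fun setT (fun t : Om => t.2) by exact: measurable_snd.
have m22 : measurable_fun setT (fun t : Om => t.2.2).
  exact: (measurableT_comp measurable_snd m2).
have mz : measurable_fun setT z by exact: measurable_fst.
have mx1' : measurable_fun setT x1 by exact: (measurableT_comp measurable_fst m2).
have mx0' : measurable_fun setT x0 by exact: (measurableT_comp measurable_fst m22).
have my : measurable_fun setT y by exact: (measurableT_comp measurable_snd m22).
have mxs : measurable_fun setT xs by exact: (measurableT_comp mT m2).
have HG D : measurable D -> H ((fun t : Om => t.2) @^-1` D) = G D.
  by move=> mD; rewrite -H0// preimage_snd.
have Hx0y C : measurable C -> H ((fun t => (x0 t, y t)) @^-1` C) = pi0 C.
  move=> mC; rewrite -G0// -HG//; last exact: measurableX.
  by congr (H _); apply/seteqP; split => -[a [b [c e]]] //= [].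
have Hx1y C : measurable C -> H ((fun t => (x1 t, y t)) @^-1` C) = pi1 C.
  move=> mC; rewrite -G1// -HG//; rewrite -[_ @^-1` _]setTI.
  apply: (measurable_fun_pair mx1 _ measurableT mC).
  exact: (measurableT_comp measurable_snd measurable_snd).
have Hxsz C : measurable C -> H ((fun t => (xs t, z t)) @^-1` C) = sg C.
  move=> mC; have mC' : measurable (swap @^-1` C).
    by rewrite -[_ @^-1` _]setTI; exact: (mswap measurableT _ mC).
  rewrite (_ : _ @^-1` C = (fun t => (t.1, interpolate s t.2)) @^-1` (swap @^-1` C))//.
  rewrite H1// [LHS]lawE; congr (sg _).
  by apply/seteqP; split => -[a b].
have Hx0 A : measurable A -> H (x0 @^-1` A) = mu0 A.
  move=> mA; rewrite -Gx0// -HG// -[_ @^-1` _]setTI; exact: (mx0 measurableT _ mA).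
have Hx1 A : measurable A -> H (x1 @^-1` A) = mu1 A.
  move=> mA; rewrite -Gx1// -HG// -[_ @^-1` _]setTI; exact: (mx1 measurableT _ mA).
have Hxs A : measurable A -> H (xs @^-1` A) = mus A.
  move=> mA; transitivity (G (interpolate s @^-1` A)); last by [].
  rewrite -HG// -[_ @^-1` _]setTI; exact: (mT measurableT _ mA).
have Hy A : measurable A -> H (y @^-1` A) = nubar A.
  move=> mA; rewrite -pi0r// -Hx0y// -[_ @^-1` _]setTI; exact: measurable_snd.
have Hz A : measurable A -> H (z @^-1` A) = nu A.
  move=> mA; rewrite -sgr// -Hxsz// -[_ @^-1` _]setTI; exact: measurable_snd.
pose I (f g : Om -> X) := (\int[H]_t (sqnorm ((f t : 'rV[R]_n) - (g t : 'rV[R]_n)))%:E)%E.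
(* couplings of these three pairs are arbitrary, those of the next three optimal *)
have Ixsy : ((W2sq mus nubar)%:E <= I xs y)%E by exact: W2sq_le_law.
have Ix0z : ((W2sq mu0 nu)%:E <= I x0 z)%E by exact: W2sq_le_law.
have Ix1z : ((W2sq mu1 nu)%:E <= I x1 z)%E by exact: W2sq_le_law.
have Ixsz : ((W2sq mus nu)%:E = I xs z)%E by rewrite sgE; exact: transport_cost_law.
have Ix0y : ((W2sq mu0 nubar)%:E = I x0 y)%E by rewrite pi0E; exact: transport_cost_law.
have Ix1y : ((W2sq mu1 nubar)%:E = I x1 y)%E by rewrite pi1E; exact: transport_cost_law.
have Isum (f g : Om -> X) : measurable_fun setT f -> measurable_fun setT g ->
    (I xs f + ((1 - s)%:E * I x0 g + s%:E * I x1 g) =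
    \int[H]_t (sqnorm ((xs t : 'rV[R]_n) - (f t : 'rV[R]_n)) +
      ((1 - s) * sqnorm ((x0 t : 'rV[R]_n) - (g t : 'rV[R]_n)) +
       s * sqnorm ((x1 t : 'rV[R]_n) - (g t : 'rV[R]_n))))%:E)%E.
  move=> mf mg.
  have s0' := ltW s0.
  by rewrite ge0_integral_comb// => [|||t|t|t];
    first [exact: sqnorm_ge0|exact: measurable_sqdist].
have key : (I xs y + ((1 - s)%:E * I x0 z + s%:E * I x1 z) =
    I xs z + ((1 - s)%:E * I x0 y + s%:E * I x1 y))%E.
  rewrite !Isum//; apply: eq_integral => t _; congr EFin.
  exact: sqnorm_interpolate_sub.
rewrite -Ixsz -Ix0y -Ix1y in key.
have : ((W2sq mus nubar)%:E + ((1 - s)%:E * (W2sq mu0 nu)%:E + s%:E * (W2sq mu1 nu)%:E) <=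
  (W2sq mus nu)%:E + ((1 - s)%:E * (W2sq mu0 nubar)%:E + s%:E * (W2sq mu1 nubar)%:E))%E.
  rewrite -key; apply: leeD => //; apply: leeD; rewrite lee_wpmul2l// lee_fin ltW//.
rewrite -!EFinM -!EFinD lee_fin; lra.
Qed.

End generalized_geodesic.

(** A P2 measure contains a set function that is arbitrary on nonmeasurable sets,
    so the laws of x0 and x1 need not be equal to mu0 and mu1: the curve is set
    to mu0 and mu1 at the endpoints, and to the law of xs at the interior times,
    which are the ones that the segment inequality is about. *)
Theorem corollary1p6 (R : realType) (n : nat) : NNCC_space (@W2sq R n).
Proof.
move=> mu0 mu1 nubar.
have /choice[x xP] : forall s : {i01 R}, exists mus : P2 R n,
    [/\ s = 0%:i01 -> mus = mu0, s = 1%:i01 -> mus = mu1 &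
    0 < s%:num < 1 -> forall nu : P2 R n, W2sq mus nubar - W2sq mus nu <=
    (1 - s%:num) * (W2sq mu0 nubar - W2sq mu0 nu) +
    s%:num * (W2sq mu1 nubar - W2sq mu1 nu)].
  move=> s; have [s0|] := pselect (s = 0%:i01).
    exists mu0; split => // [s1|]; last by rewrite s0 /= ltxx.
    have n0 : s%:num = 0 by rewrite s0.
    have n1 : s%:num = 1 by rewrite s1.
    by move/eqP: n1; rewrite n0 eq_sym oner_eq0.
  have [s1|s1 s0] := pselect (s = 1%:i01).
    by exists mu1; split => //; rewrite s1 /= ltxx andbF.
  have [s01|s01] := boolP (0 < s%:num < 1).
    by have [mus musP] := exists_segment_point mu0 mu1 nubar s01; exists mus.
  by exists mu0.
exists x; have [x0 _ _] := xP 0%:i01; have [_ x1 _] := xP 1%:i01.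
split; [|exact: x0|exact: x1].
by move=> s nu s01; rewrite x0// x1//; have [_ _] := xP s; exact.
Qed.
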